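(* Let $T>0$ and $r,\tau\ge0$ with $r+\tau>0$, and suppose that there exists $l\in Z^+$ such that $\tau=lT$. Let $f:\mathbb{R}^n\times\mathbb{R}^m\to\mathbb{R}^n$ be locally Lipschitz with $f(0,0)=0$. Suppose that: (i) the system $\dot x(t)=f(x(t),u(t))$ is forward complete; (ii) there exist $k:\mathbb{R}^n\to\mathbb{R}^m$ and $g\in K_\infty$ with $|k(x)|\le g(|x|)$ for all $x\in\mathbb{R}^n$, and a function $\sigma\in KL$, such that for every $x_0\in\mathbb{R}^n$ the solution $x(t)$ of the delay-free sampled-data system $$\dot x(t)=f(x(t),k(x(iT))),\quad t\in[iT,(i+1)T),\ i\in Z^+,\qquad x((i+1)T)=\lim_{t\to (i+1)T^-}x(t),\qquad x(0)=x_0,\qquad (\ast)$$ satisfies $|x(t)|\le\sigma(|x_0|,t)$ for all $t\ge0$. Then the sampled-data closed-loop system $$\dot x(t)=f(x(t),u(t-\tau)),\qquad u(t)=k\big(\Phi(x(\tau_i-r),\breve T_{r+\tau}(\tau_i)u)\big),\ t\in[\tau_i,\tau_{i+1}),\ i\in Z^+,\qquad \tau_{i+1}=\tau_i+T,\ \tau_0=0,\qquad(\ast\ast)$$ where $\Phi$ is the predictor mapping, is uniformly globally asymptotically stable, in the sense that there exists $\tilde\sigma\in KL$ such that for every $(x_0,u_0)\in C^0([-r,0];\mathbb{R}^n)\times L^\infty([-r-\tau,0);\mathbb{R}^m)$ the solution $(x(t),u(t))\in\mathbb{R}^n\times\mathbb{R}^m$ of $(\ast\ast)$ with initial condition $\breve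 T_{r+\tau}(0)u=u_0$, $T_r(0)x=x_0$ satisfies, for all $t\ge0$, $$\|T_r(t)x\|_r+\|\breve T_{r+\tau}(t)u\|_{r+\tau}\le\tilde\sigma\big(\|x_0\|_r+\|u_0\|_{r+\tau},\,t\big).$$ Finally, if system $(\ast)$ satisfies the dead-beat property of order $jT$, where $j\in Z^+$ is positive, i.e., if for all $x_0\in\mathbb{R}^n$ the solution $x(t)$ of $(\ast)$ with $x(0)=x_0$ satisfies $x(t)=0$ for all $t\ge jT$, then system $(\ast\ast)$ satisfies the dead-beat property of order $\left(j+l+\left[\frac rT\right]+1\right)T$, i.e., for every $(x_0,u_0)\in C^0([-r,0];\mathbb{R}^n)\times L^\infty([-r-\tau,0);\mathbb{R}^m)$ the solution of $(\ast\ast)$ with initial condition $\breve T_{r+\tau}(0)u=u_0$, $T_r(0)x=x_0$ satisfies $x(t)=0$ for all $t\ge\left(j+l+\left[\frac rT\right]+1\right)T$.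
   Context: Notation. $\mathbb{R}^+=[0,\infty)$, $Z^+$ is the set of non-negative integers, $|\cdot|$ is the Euclidean norm, $[s]$ is the integer part of $s\ge0$. $K_\infty$ and $KL$ are the standard classes of comparison functions. $L^\infty(I;U)$ is the space of measurable and bounded functions $I\to U$; functions differing on a null set are not identified. History: $(T_r(t)x)(\theta)=x(t+\theta)$ for $\theta\in[-r,0]$ (history), and $(\breve T_r(t)x)(\theta)=x(t+\theta)$ for $\theta\in[-r,0)$ (open history). Norms: $\|x\|_r=\sup_{\theta\in[-r,0]}|x(\theta)|$ for functions on $[-r,0]$ and $\|x\|_r=\sup_{\theta\in[-r,0)}|x(\theta)|$ for functions on $[-r,0)$ (actual supremum). Convention: $C^0([-r,0];\mathbb{R}^n)=\mathbb{R}^n$ when $r=0$. Forward completeness: $\dot x=f(x,u)$ is forward complete if for every $x_0\in\mathbb{R}^n$ and every measurable, locally bounded $u:\mathbb{R}^+\to\mathbb{R}^m$, the solution with $x(0)=x_0$ exists for all $t\ge0$. Solutions of differential equations are absolutely continuous functions satisfying the equation almost everywhere. Predictor mapping: under forward completeness, for $r+\tau>0$, $\Phi:\mathbb{R}^n\times L^\infty([-r-\tau,0);\mathbb{R}^m)\to\mathbb{R}^n$ is defined by $\Phi(x_0,u)=x(\tau)$, where $x(\cdot)$ is the solution of $\dot x(t)=f(x(t),u(t-\tau))$ on $[-r,\tau]$ with $x(-r)=x_0$. *)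

(* Defs.v *)
From mathcomp Require Import all_boot all_order all_algebra.
From mathcomp Require Import all_classical all_reals all_analysis.
From mathcomp Require Import measurable_realfun.
Set Implicit Arguments.
Unset Strict Implicit.
Unset Printing Implicit Defensive.
Import Order.TTheory GRing.Theory Num.Theory.
Import numFieldNormedType.Exports.
Local Open Scope classical_set_scope.
Local Open Scope ring_scope.

(* Functions on a subset D of R are total functions R -> _ of which only the
   values on D are ever constrained or used. *)

(* Euclidean norm; the norm `|x| of the library on row vectors is the max norm *)
Definition enorm (R : realType) (n : nat) (x : 'rV[R]_n) : R :=
  Num.sqrt (\sum_(i < n) x 0 i ^+ 2).

(* A real supremum: it is 0 by convention when D is empty or when x is
   unbounded on D, which never happens for the solutions considered here. *)
Definition supnorm (R : realType) (n : nat) (D : set R) (x : R -> 'rV[R]_n) : R :=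
  sup [set enorm (x t) | t in D].

Definition history (R : realType) (V : Type) (t : R) (x : R -> V) : R -> V :=
  fun theta => x (t + theta).

Definition class_K (R : realType) (a : R -> R) : Prop :=
  [/\ {within `[0, +oo[, continuous a},
      a 0 = 0 &
      forall s s' : R, 0 <= s -> s < s' -> a s < a s'].

Definition class_Kinf (R : realType) (a : R -> R) : Prop :=
  class_K a /\ a s @[s --> +oo] --> +oo.

Definition class_KL (R : realType) (sigma : R -> R -> R) : Prop :=
  [/\ {within `[0, +oo[ `*` `[0, +oo[, continuous (fun p : R * R => sigma p.1 p.2)},
      forall t : R, 0 <= t -> class_K (sigma ^~ t),
      forall s : R, 0 <= s ->
        forall t t' : R, 0 <= t -> t <= t' -> sigma s t' <= sigma s t &
      forall s : R, 0 <= s -> sigma s t @[t --> +oo] --> 0].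

(* Measurability is with respect to the completed (Lebesgue) sigma-algebra:
   measurable_fun on R alone would mean Borel measurability. *)
Definition lebesgue_measurable_fun (R : realType) (D : set R) (h : R -> R) : Prop :=
  @measurable_fun _ _
    (g_sigma_algebraType (completed_algebra_gen (@lebesgue_measure R)))
    (measurableTypeR R) D h.

Definition measurable_on (R : realType) (m : nat) (D : set R)
    (u : R -> 'rV[R]_m) : Prop :=
  forall i : 'I_m, lebesgue_measurable_fun D (fun t => u t 0 i).

Definition bounded_on (R : realType) (m : nat) (D : set R)
    (u : R -> 'rV[R]_m) : Prop :=
  exists M : R, forall t, D t -> enorm (u t) <= M.

Definition Linfty_on (R : realType) (m : nat) (D : set R)
    (u : R -> 'rV[R]_m) : Prop :=
  measurable_on D u /\ bounded_on D u.

Definition locally_lipschitz (R : realType) (n m : nat)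
    (f : 'rV[R]_n -> 'rV[R]_m -> 'rV[R]_n) : Prop :=
  forall p : 'rV[R]_n * 'rV[R]_m,
    exists2 U, nbhs p U & [lipschitz f q.1 q.2 | q in U].

Definition abs_continuous_on (R : realType) (n : nat) (a b : R)
    (x : R -> 'rV[R]_n) : Prop :=
  forall e : R, 0 < e -> exists2 d : R, 0 < d &
    forall (N : nat) (s t : 'I_N -> R),
      (forall i, [/\ a <= s i, s i <= t i & t i <= b]) ->
      trivIset setT (fun i => `]s i, t i[%classic) ->
      \sum_(i < N) (t i - s i) < d ->
      \sum_(i < N) enorm (x (t i) - x (s i)) < e.

(* Solution of x'(t) = F(t, x(t)) on the interval I. Only the interior of I
   matters for the derivative, as the equation holds almost everywhere. *)
Definition ode_solution (R : realType) (n : nat)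
    (F : R -> 'rV[R]_n -> 'rV[R]_n) (I : set R) (x : R -> 'rV[R]_n) : Prop :=
  (forall a b, a <= b -> `[a, b] `<=` I -> abs_continuous_on a b x) /\
  (\forall t \ae (@lebesgue_measure R),
     I° t -> is_derive (t : R) (1 : R) x (F t (x t))).

Definition forward_complete (R : realType) (n m : nat)
    (f : 'rV[R]_n -> 'rV[R]_m -> 'rV[R]_n) : Prop :=
  forall (x0 : 'rV[R]_n) (u : R -> 'rV[R]_m),
    measurable_on `[0, +oo[ u ->
    (forall b : R, bounded_on `[0, b] u) ->
    exists x : R -> 'rV[R]_n,
      ode_solution (fun t y => f y (u t)) `[0, +oo[ x /\ x 0 = x0.

(* The value is determined only when the initial value problem has a unique
   solution on [-r, tau], as is the case when f is locally Lipschitz and forward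
   complete and u is measurable and bounded on [-r - tau, 0). *)
Definition predictor (R : realType) (n m : nat)
    (f : 'rV[R]_n -> 'rV[R]_m -> 'rV[R]_n) (r tau : R)
    (x0 : 'rV[R]_n) (u : R -> 'rV[R]_m) : 'rV[R]_n :=
  xget 0 [set y | exists x : R -> 'rV[R]_n,
    [/\ ode_solution (fun t z => f z (u (t - tau))) `[- r, tau] x,
        x (- r) = x0 & x tau = y]].

Definition sampled_solution (R : realType) (n m : nat)
    (f : 'rV[R]_n -> 'rV[R]_m -> 'rV[R]_n) (k : 'rV[R]_n -> 'rV[R]_m) (T : R)
    (x : R -> 'rV[R]_n) : Prop :=
  forall i : nat,
    ode_solution (fun _ y => f y (k (x (i%:R * T))))
      `[i%:R * T, i.+1%:R * T[ x /\
    x t @[t --> (i.+1%:R * T)^'-] --> x (i.+1%:R * T).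

Definition predictor_solution (R : realType) (n m : nat)
    (f : 'rV[R]_n -> 'rV[R]_m -> 'rV[R]_n) (k : 'rV[R]_n -> 'rV[R]_m)
    (T r tau : R) (x : R -> 'rV[R]_n) (u : R -> 'rV[R]_m) : Prop :=
  ode_solution (fun t y => f y (u (t - tau))) `[0, +oo[ x /\
  (forall (i : nat) (t : R), i%:R * T <= t -> t < i.+1%:R * T ->
     u t = k (predictor f r tau (x (i%:R * T - r)) (history (i%:R * T) u))).

Definition initial_condition (R : realType) (n m : nat) (r tau : R)
    (x0 : R -> 'rV[R]_n) (u0 : R -> 'rV[R]_m)
    (x : R -> 'rV[R]_n) (u : R -> 'rV[R]_m) : Prop :=
  {in `[- r, 0], x =1 x0} /\ {in `[- r - tau, 0[, u =1 u0}.

(* Main.v *)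
From HB Require Import structures.
Require Import Defs.
From mathcomp Require Import all_boot all_order all_algebra.
From mathcomp Require Import all_classical all_reals all_analysis.
From mathcomp Require Import measurable_realfun lra ring.

(** The predictor computes the state [tau] time units ahead from the state
    measured [r] time units ago and from the control of the last [r + tau] time
    units. Once the measured states obey the differential equation, that is from
    the first sampling instant [i0 * T] after [r], the prediction is exact
    ([predictor_exact]), and the control applied to the plant at a time [t] is
    [k] evaluated at the state at the sampling instant preceding [t], because
    [tau] is a multiple of [T].
    From time [i0 * T + tau] on, the state is therefore a trajectory of the
    delay-free sampled-data system ([sampled_tail]). The dead-beat property
    follows at once, and the KL estimate holds for large times, with the size
    of the state at time [i0 * T + tau] in place of that of the initial
    condition.

    What remains is the transient: over finitely many sampling periods, the
    state and the control must be bounded by a class-K function of the size of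
    the initial condition ([closed_loop_bound]). This rests on a property of
    forward complete systems with locally Lipschitz right-hand sides: over a
    bounded time, bounded initial states and bounded inputs produce bounded
    states ([bounded_reachability]). If they did not, some point would have
    trajectories that start arbitrarily near it and become arbitrarily large.
    Following such trajectories until they cross a larger sphere and passing
    to the limit gives a further point of the same kind, and so on
    ([blows_up_step]). Since the flow is an open map of the initial state
    ([flow_open]), the initial state of the pieces found so far can be adjusted
    so that each piece starts where the previous one ends. In the limit a single
    input and a single initial state give a trajectory that is unbounded in
    finite time, against forward completeness. Near the equilibrium a Gronwall
    estimate gives smallness of the states instead of mere boundedness, and a
    class-K majorant follows ([flow_extK]).

    Openness is obtained without integrating backwards: over a short time the
    flow is the identity plus a contraction, hence onto a neighbourhood by the
    Banach fixed point theorem. All estimates come from a mean value inequality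
    for absolutely continuous functions ([mean_value]), which needs the
    derivative only almost everywhere; no integral appears. *)

Set Implicit Arguments.
Unset Strict Implicit.
Unset Printing Implicit Defensive.
Import Order.TTheory GRing.Theory Num.Theory.
Import numFieldNormedType.Exports.
Local Open Scope classical_set_scope.
Local Open Scope ring_scope.

(** * Euclidean norm and maximum norm *)

Section EuclideanNorm.
Variables (R : realType) (n : nat).
Implicit Type v : 'rV[R]_n.

Lemma norm_rV_le v (c : R) :
  0 <= c -> (forall i, `|v 0 i| <= c) -> `|v| <= c.
Proof.
move=> c0 vc; rewrite [leLHS]/Num.norm/= mx_normrE; apply/bigmax_leP; split=> //.
by move=> [i j] _ /=; rewrite (ord1 i); exact: vc.
Qed.

Lemma coord_le_norm v i : `|v 0 i| <= `|v|.
Proof.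
rewrite [leRHS]/Num.norm/= mx_normrE.
by rewrite (le_bigmax _ (fun ij : 'I_1 * 'I_n => `|v ij.1 ij.2|) (0, i)).
Qed.

Lemma enorm_ge0 v : 0 <= enorm v.
Proof. exact: sqrtr_ge0. Qed.

Lemma norm_le_enorm v : `|v| <= enorm v.
Proof.
apply: norm_rV_le (enorm_ge0 v) _ => i.
rewrite -sqrtr_sqr ler_wsqrtr// (bigD1 i)//= lerDl.
by apply: sumr_ge0 => j _; exact: sqr_ge0.
Qed.

(** With [norm_le_enorm], estimates may be made in the maximum norm, for which
    row vectors are a normed module, at the cost of a factor [n]. *)
Lemma enorm_le_norm v : enorm v <= n%:R * `|v|.
Proof.
have nv0 : 0 <= n%:R * `|v| by rewrite mulr_ge0.
rewrite -(ger0_norm nv0) -sqrtr_sqr ler_wsqrtr// exprMn.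
apply: (@le_trans _ _ (\sum_(i < n) `|v| ^+ 2)).
  apply: ler_sum => i _; rewrite -real_normK ?num_real//.
  by rewrite lerXn2r ?nnegrE//; exact: coord_le_norm.
rewrite sumr_const card_ord -[leLHS]mulr_natl ler_wpM2r ?sqr_ge0//.
by rewrite -natrX ler_nat; case: n => // k; rewrite leq_pmulr.
Qed.

End EuclideanNorm.

(** * Absolute continuity and the mean value inequality *)

Section AlmostEverywhere.
Variable R : realType.
Implicit Types P Q : R -> Prop.

Lemma aeS P Q : (forall t, P t -> Q t) ->
  (\forall t \ae (@lebesgue_measure R), P t) ->
  \forall t \ae (@lebesgue_measure R), Q t.
Proof.
by move=> PQ; apply: negligibleS => t nQ /PQ; exact: nQ.
Qed.

Lemma aeI P Q : (\forall t \ae (@lebesgue_measure R), P t) ->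
  (\forall t \ae (@lebesgue_measure R), Q t) ->
  \forall t \ae (@lebesgue_measure R), P t /\ Q t.
Proof.
move=> aP aQ; apply: negligibleS (negligibleU aP aQ).
by move=> t /= /not_andP.
Qed.

End AlmostEverywhere.

Section MeanValue.
Variables (R : realType) (n : nat).
Implicit Types (z : R -> 'rV[R]_n) (a b c : R).

Definition cons_last (X : Type) (N : nat) (s : nat -> X) (x : X) : nat -> X :=
  fun i => if (i < N)%N then s i else x.

(** Families of intervals are listed from left to right, so that appending an
    interval on the right preserves disjointness. *)
Definition interval_chain (S T : nat -> R) N a b :=
  (forall i, (i < N)%N -> [/\ a <= S i, S i <= T i & T i <= b]) /\
  (forall i j, (i < j)%N -> (j < N)%N -> T i <= S j).

Lemma chain_trivIset (S T : nat -> R) N a b : interval_chain S T N a b ->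
  trivIset setT (fun i => if (i < N)%N then `]S i, T i[%classic else set0).
Proof.
move=> [_ ST]; apply: ltn_trivIset => i j ij.
case: ifPn => iN; last by rewrite set0I.
case: ifPn => jN; last by rewrite setI0.
rewrite -subset0 => x [/=]; rewrite !in_itv/= => /andP[Sx xT] /andP[Sjx xTj].
by have := ST _ _ ij jN; rewrite leNgt (lt_trans Sjx xT).
Qed.

Lemma chain_length (S T : nat -> R) N a b (G : set R) : interval_chain S T N a b ->
  open G -> (forall i, (i < N)%N -> `]S i, T i[ `<=` G) ->
  ((\sum_(i < N) (T i - S i))%:E <= lebesgue_measure G)%E.
Proof.
move=> chST oG STG; have [STab _] := chST.
pose F i := if (i < N)%N then `]S i, T i[%classic else set0.
have mF i : measurable (F i : set (measurableTypeR R)).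
  by rewrite /F; case: ifP.
have -> : ((\sum_(i < N) (T i - S i))%:E = lebesgue_measure (\big[setU/set0]_(i < N) F i))%E.
  rewrite (measure_bigsetU (lebesgue_measure) mF (chain_trivIset chST)).
  rewrite -sumEFin; apply: eq_bigr => i _; rewrite /F ltn_ord.
  rewrite [RHS](@lebesgue_measure_itv R `]S i, T i[)/= lte_fin; case: ltP => // TS.
  have [_ ST _] := STab i (ltn_ord i).
  by rewrite (le_anti (introT andP (conj TS ST))) subrr.
apply: le_measure; rewrite ?inE.
- exact: bigsetU_measurable.
- exact: open_measurable.
- rewrite -bigcup_mkord => x [i /= iN]; rewrite /F iN; exact: STG.
Qed.

(** Disjoint intervals inside [G] have total length at most the measure of
    [G]: absolute continuity therefore controls the variation of [z] inside
    open sets of small measure. *)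
Lemma abs_continuous_open z a b : abs_continuous_on a b z ->
  forall e : R, 0 < e -> exists2 d : R, 0 < d &
    forall (G : set R) (S T : nat -> R) N, open G ->
    (lebesgue_measure G < d%:E)%E -> interval_chain S T N a b ->
    (forall i, (i < N)%N -> `]S i, T i[ `<=` G) ->
    \sum_(i < N) `|z (T i) - z (S i)| < e.
Proof.
move=> acz e e0; have [d d0 zd] := acz e e0; exists d => // G S T N oG Gd chST STG.
apply: (@le_lt_trans _ _ (\sum_(i < N) enorm (z (T i) - z (S i)))).
  by apply: ler_sum => i _; exact: norm_le_enorm.
apply: (zd N (fun i => S i) (fun i => T i)).
- by move=> i; have [+ _] := chST; exact.
- move=> i j _ _ STij; have := chain_trivIset chST.
  by move/(_ i j I I); rewrite !ltn_ord => /(_ STij)/ord_inj.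
- rewrite -lte_fin; apply: le_lt_trans Gd.
  exact: chain_length chST oG STG.
Qed.

Lemma abs_continuous_unif z a b : abs_continuous_on a b z ->
  forall e : R, 0 < e -> exists2 d : R, 0 < d &
    forall s t, a <= s <= b -> a <= t <= b -> `|t - s| < d ->
      `|z t - z s| < e.
Proof.
move=> acz e e0; have [d d0 zd] := acz e e0; exists d => // s t.
wlog st : s t / s <= t => [hw sab tab std|].
  have [/hw|/ltW/hw] := leP s t; first exact.
  by rewrite [`|z t - _|]distrC; apply=> //; rewrite distrC.
move=> /andP[a_s sb] /andP[a_t tb]; rewrite ger0_norm ?subr_ge0// => std.
have := zd 1%N (fun=> s) (fun=> t); rewrite !big_ord1.
move=> h; apply: le_lt_trans (norm_le_enorm _) _; apply: h => //.
by move=> i j _ _ _; rewrite (ord1 i) (ord1 j).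
Qed.

(** Splitting an increment at [t] applies the definition of the derivative to
    both parts; the two ends of the interval vary independently, as the
    covering argument of [mean_value] requires. *)
Lemma derive_straddle z (t C : R) v : is_derive t 1 z v -> `|v| < C ->
  exists2 d : R, 0 < d & forall s s', t - d < s -> s <= t -> t <= s' ->
    s' < t + d -> `|z s' - z s| <= C * (s' - s).
Proof.
move=> [dz zv] vC.
have /cvgrPdist_lt/(_ (C - `|v|)) : 
   h^-1 *: ((z \o shift t) (h *: (1 : R)) - z t) @[h --> 0^'] --> v by rewrite -zv; exact: dz.
rewrite subr_gt0 => /(_ vC) [d /= d0 zd]; exists d => // s s'.
have half h : `|h| < d -> `|z (t + h) - z t| <= C * `|h|.
  move=> hd; have [->|h0] := eqVneq h 0; first by rewrite addr0 subrr !normr0 mulr0.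
  have := zd h; rewrite /= sub0r normrN => /(_ hd h0); rewrite /shift/= scaler1 [h + t]addrC => hv.
  have hn0 : 0 < `|h| by rewrite normr_gt0.
  rewrite -ler_pdivrMr// mulrC -normfV -normrZ.
  rewrite -(subrK v (h^-1 *: _)) (le_trans (ler_normD _ _))// -lerBrDr.
  by rewrite distrC ltW.
move=> ts st ts' s't.
have -> : z s' - z s = (z s' - z t) - (z s - z t) by rewrite opprB addrA subrK.
rewrite (le_trans (ler_normB _ _))//.
have := half (s' - t); rewrite ger0_norm ?subr_ge0// addrCA subrr addr0 ltrBlDl => /(_ s't) h1.
have := half (s - t); rewrite ler0_norm ?subr_le0// addrCA subrr addr0.
rewrite opprB ltrBlDr addrC -ltrBlDr => h2.
have {}h2 := h2 ts.
by rewrite (le_trans (lerD h1 h2))// -mulrDr addrA subrK.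
Qed.

(** The exceptional null set is enclosed in an open set [G] of small measure.
    Travelling from [a] to [b], every point is passed either by a short step
    that obeys the derivative bound, or by an interval contained in [G]; steps
    of the second kind contribute at most [e] in total by absolute continuity.
    The supremum of the points that can be reached in this way is [b]. *)
Lemma mean_value z a b (C : R) : a <= b -> 0 <= C -> abs_continuous_on a b z ->
  (\forall t \ae (@lebesgue_measure R), a < t < b ->
     exists2 v, is_derive (t : R) (1 : R) z v & `|v| <= C) ->
  `|z b - z a| <= C * (b - a).
Proof.
move=> ab C0 acz [N [mN N0 zN]].
apply/ler_addgt0Pr => e0 e0_gt0.
pose e := e0 / (b - a + 1).
have ba1 : 0 < b - a + 1 by rewrite ltr_wpDl ?subr_ge0.
have e_gt0 : 0 < e by rewrite divr_gt0.
suff : `|z b - z a| <= (C + e) * (b - a) + e.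
  move=> /le_trans; apply; rewrite mulrDl -addrA lerD2l.
  by rewrite -[leLHS]addrC -{1}(mulr1 e) -mulrDr addrC /e divfK// gt_eqF.
have [d d0 zd] := abs_continuous_open acz e_gt0.
(* the endpoints, where no derivative is assumed, join the null set *)
pose N' : set (measurableTypeR R) := N `|` ([set a] `|` [set b]).
have m1 (x : R) : measurable ([set x] : set (measurableTypeR R)).
  exact: measurable_set1.
have mN' : measurable N' by do 2 (apply: measurableU => //).
have N'0 : (lebesgue_measure N' = 0)%E.
  apply: null_set_setU => //; first exact: measurableU.
  by apply: null_set_setU => //; exact: lebesgue_measure_set1.
have [G [oG N'G Gd]] : exists G : set R, [/\ open G, N' `<=` G & (lebesgue_measure G < d%:E)%E].
  have N'oo : (lebesgue_measure N' < +oo)%E by rewrite N'0.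
  have [G [oG NG Gd]] := lebesgue_regularity_outer mN' N'oo d0.
  exists G; split=> //.
  rewrite -(setDUK NG) setUC measureU0//.
  by apply: measurableD => //; exact: open_measurable.
(* [Q s]: the point [s] can be reached from [a] *)
pose Q s := exists M S T, [/\ interval_chain S T M a s,
  forall i, (i < M)%N -> `]S i, T i[ `<=` G &
  `|z s - z a| <= (C + e) * (s - a) + \sum_(i < M) `|z (T i) - z (S i)|].
suff [M [S [T [chST STG zb]]]] : Q b.
  by rewrite (le_trans zb)// lerD2l ltW//; exact: zd chST STG.
have Qa : Q a.
  exists 0%N, (fun=> a), (fun=> a); rewrite big_ord0 !subrr mulr0 normr0 addr0.
  by split=> //; split.
have step c : a <= c <= b -> exists2 d : R, 0 < d & forall s s',
    c - d < s -> s <= c -> c <= s' -> s' < c + d -> a <= s -> s' <= b -> Q s -> Q s'.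
  move=> /andP[ac cb].
  have [Gc|nGc] := pselect (G c).
    have [d' /= d'0 cd'] : nbhs c G by move: oG; rewrite openE; exact.
    exists d' => // s s' cs sc cs' s'c a_s s'b [M [S [T [[chS chT] STG zs]]]].
    have ss' : s <= s' := le_trans sc cs'.
    exists M.+1, (cons_last M S s), (cons_last M T s'); split.
    - split=> [i|i j ij]; rewrite /cons_last ltnS leq_eqVlt.
        move=> /orP[/eqP ->|iM]; first by rewrite ltnn.
        rewrite iM; have [h1 h2 h3] := chS _ iM; split=> //; exact: le_trans h3 ss'.
      move=> /orP[/eqP jM|jM].
        by move: ij; rewrite jM ltnn => iM; rewrite iM; have [] := chS _ iM.
      by rewrite (ltn_trans ij jM) jM; exact: chT.
    - move=> i; rewrite /cons_last ltnS leq_eqVlt => /orP[/eqP ->|iM].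
        rewrite ltnn => x /=; rewrite in_itv/= => /andP[sx xs']; apply: cd' => /=.
        by rewrite ltr_distlC (lt_trans cs sx) (lt_trans xs' s'c).
      by rewrite iM; exact: STG.
    - rewrite big_ord_recr/= /cons_last ltnn.
      rewrite (eq_bigr (fun i : 'I_M => `|z (T i) - z (S i)|)); last first.
        by move=> i _; rewrite ltn_ord.
      have -> : z s' - z a = (z s - z a) + (z s' - z s) by rewrite [RHS]addrC subrKA.
      rewrite (le_trans (ler_normD _ _))// addrA lerD2r (le_trans zs)// lerD2r.
      by rewrite ler_wpM2l ?lerB// addr_ge0// ltW.
  have cN' : ~ N' c by move=> /N'G.
  have acb : a < c < b.
    have [ca cb'] : c != a /\ c != b.
      by split; apply/eqP => cE; apply: cN'; rewrite cE; right; [left|right].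
    by rewrite !lt_neqAle ac cb cb' eq_sym ca.
  have [v zv vC] : exists2 v, is_derive (c : R) (1 : R) z v & `|v| <= C.
    apply: contrapT => nv; apply: cN'; left; apply: zN => /= /(_ acb); exact: nv.
  have [|d' d'0 zd'] := derive_straddle (C := C + e) zv; first by rewrite (le_lt_trans vC)// ltrDl.
  exists d' => // s s' cs sc cs' s'c a_s s'b [M [S [T [[chS chT] STG zs]]]].
  have ss' : s <= s' := le_trans sc cs'.
  exists M, S, T; split=> //.
    by split=> // i iM; have [h1 h2 h3] := chS _ iM; split=> //; exact: le_trans h3 ss'.
  have -> : z s' - z a = (z s - z a) + (z s' - z s) by rewrite [RHS]addrC subrKA.
  rewrite (le_trans (ler_normD _ _))// (le_trans (lerD zs (zd' _ _ cs sc cs' s'c)))//.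
  by lra.
pose E := [set s | a <= s <= b /\ Q s].
have Ea : E a by split=> //; rewrite lexx ab.
have ubE : ubound E b by move=> s [/andP[]].
have supE : has_sup E by split; [exists a|exists b].
pose c := sup E.
have acb : a <= c <= b.
  apply/andP; split; first by apply: ub_le_sup Ea; exists b.
  by apply: ge_sup ubE; exists a.
have [d' d'0 stepc] := step c acb.
have [s [/andP[a_s sb] Qs] cs] := sup_adherent d'0 supE.
have sc : s <= c by apply: ub_le_sup; [exists b|rewrite /E/= a_s sb].
have Qc : Q c.
  apply: (stepc s c) => //; first by rewrite ltrDl.
  by case/andP: acb.
case/andP: acb => ac; rewrite le_eqVlt => /orP[/eqP <-//|cb].
pose s' := Num.min b (c + d' / 2).
have cs' : c < s' by rewrite /s' lt_min cb ltrDl divr_gt0.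
suff : E s' by move=> /(ub_le_sup (ex_intro _ b ubE)); rewrite leNgt cs'.
split; first by rewrite (le_trans ac (ltW cs')) ge_min lexx.
apply: (stepc s s') => //; first exact: ltW.
- by rewrite gt_min; apply/orP; right; rewrite ltrD2l gtr_pMr// invf_lt1// ltr1n.
- by rewrite ge_min lexx.
Qed.

End MeanValue.

(** * Gronwall estimates *)

Section Gronwall.
Variables (R : realType) (n : nat).
Implicit Types (z : R -> 'rV[R]_n) (a b c : R).

(** The infimum of the times at which [phi] is at least [K]. *)
Lemma first_hit (phi : R -> R) a b (K t1 : R) :
  (forall t, a <= t <= b -> forall e : R, 0 < e -> exists2 d : R, 0 < d &
     forall s, a <= s <= b -> `|s - t| < d -> `|phi s - phi t| < e) ->
  a <= t1 <= b -> phi a < K -> K <= phi t1 ->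
  exists s, [/\ a < s, s <= t1, phi s = K & forall t, a <= t <= s -> phi t <= K].
Proof.
move=> phic /andP[at1 t1b] phia Kt1.
pose E := [set s | a <= s <= t1 /\ K <= phi s].
have Et1 : E t1 by rewrite /E/= lexx at1.
have lbE : lbound E a by move=> s [/andP[]].
have infE : has_inf E by split; [exists t1|exists a].
pose s := inf E.
have a_s : a <= s by apply: lb_le_inf lbE; exists t1.
have st1 : s <= t1 by apply: ge_inf Et1; exists a.
have sb : s <= b := le_trans st1 t1b.
have below t : a <= t -> t < s -> phi t < K.
  move=> a_t ts; rewrite ltNge; apply/negP => Kt.
  have : E t by rewrite /E/= a_t Kt (le_trans (ltW ts)).
  move=> /(ge_inf (ex_intro _ a lbE)); rewrite -/s leNgt ts //.
have Ks : K <= phi s.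
  rewrite leNgt; apply/negP => sK.
  have [||d d0 sd] := phic s _ (K - phi s); rewrite ?subr_gt0 ?a_s//.
  have [t [/andP[a_t tt1] Kt] ts] := inf_adherent d0 infE.
  have st : s <= t by apply: ge_inf; [exists a|rewrite /E/= a_t tt1].
  have := sd t; rewrite a_t (le_trans tt1)//= ger0_norm ?subr_ge0//.
  rewrite ltrBlDl => /(_ isT ts); apply/negP; rewrite -leNgt.
  by rewrite (le_trans _ (ler_norm _))// lerD2r.
have lt_as : a < s.
  rewrite lt_neqAle a_s andbT; apply/eqP => sE.
  by move: phia; rewrite sE ltNge Ks.
have sK : phi s <= K.
  rewrite leNgt; apply/negP => Ks'.
  have [||d d0 sd] := phic s _ (phi s - K); rewrite ?subr_gt0 ?a_s//.
  pose t := Num.max a (s - d / 2).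
  have ts : t < s by rewrite /t gt_max lt_as/= gtrBl divr_gt0.
  have a_t : a <= t by rewrite /t le_max lexx.
  have := sd t; rewrite a_t (le_trans (ltW ts))//= distrC ger0_norm ?subr_ge0//; last exact: ltW.
  have ds : s - t < d.
    rewrite ltrBlDl -ltrBlDr /t lt_max; apply/orP; right.
    by rewrite ltrD2l ltrN2 gtr_pMr// invf_lt1// ltr1n.
  move=> /(_ isT ds); apply/negP; rewrite -leNgt distrC.
  by rewrite (le_trans _ (ler_norm _))// lerD2l lerN2 ltW// below.
exists s; split=> //; first by apply/eqP; rewrite eq_le sK.
move=> t /andP[a_t]; rewrite le_eqVlt => /orP[/eqP ->//|ts].
by rewrite ltW// below.
Qed.

Lemma abs_continuous_sub z a b a' b' : a <= a' -> b' <= b ->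
  abs_continuous_on a b z -> abs_continuous_on a' b' z.
Proof.
move=> aa' b'b acz e e0; have [d d0 zd] := acz e e0; exists d => // N s t st.
apply: zd => i; have [h1 h2 h3] := st i.
by split=> //; [exact: le_trans h1|exact: le_trans h3 b'b].
Qed.

Lemma abs_continuous_norm z a b : abs_continuous_on a b z ->
  forall t, a <= t <= b -> forall e : R, 0 < e -> exists2 d : R, 0 < d &
     forall s, a <= s <= b -> `|s - t| < d -> `| `|z s| - `|z t| | < e.
Proof.
move=> acz t tab e e0; have [d d0 zd] := abs_continuous_unif acz e0.
exists d => // s sab std; apply: le_lt_trans (zd t s tab sab std).
exact: ler_dist_dist.
Qed.

(** If the conclusion failed, there would be a first time [s] at which
    [`|z| + c] takes a value [K] larger than twice its initial value. By the
    mean value inequality it grows by at most [K / 2] until [s], so that [K]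
    is at most twice the initial value. The differential inequality is needed
    only where [`|z|] is at most [rho], because the estimate keeps [z] there. *)
Lemma gronwall_step z a b (L c rho : R) : a <= b -> (b - a) * L * 2 <= 1 ->
  0 <= L -> 0 <= c -> abs_continuous_on a b z ->
  (\forall t \ae (@lebesgue_measure R), a < t < b -> `|z t| <= rho ->
     exists2 v, is_derive (t : R) (1 : R) z v & `|v| <= L * (`|z t| + c)) ->
  2 * (`|z a| + c) < rho ->
  forall t, a <= t <= b -> `|z t| + c <= 2 * (`|z a| + c).
Proof.
move=> ab baL L0 c0 acz dz zarho t1 t1ab; rewrite leNgt; apply/negP => zt1.
have za0 : 0 <= `|z a| by exact: normr_ge0.
pose K := Num.min (`|z t1| + c) rho.
have KK : 2 * (`|z a| + c) < K by rewrite /K lt_min zt1.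
have Krho : K <= rho by rewrite /K ge_min lexx orbT.
have K0 : 0 <= K by rewrite (le_trans _ (ltW KK))// mulr_ge0 ?addr_ge0.
have [||s [a_s st1 zs zbelow]] := first_hit (K := K - c) (abs_continuous_norm acz) t1ab.
- by lra.
- by rewrite lerBlDr /K ge_min lexx.
have /andP[_ t1b] := t1ab.
have sb : s <= b := le_trans st1 t1b.
have : `|z s - z a| <= L * K * (s - a).
  apply: mean_value (ltW a_s) _ (abs_continuous_sub (lexx a) sb acz) _; first exact: mulr_ge0.
  apply: aeS dz => t dz /andP[a_t ts].
  have zt : `|z t| <= K - c by apply: zbelow; rewrite !ltW.
  case: dz => [||v zv vL]; first by rewrite a_t (lt_le_trans ts).
    by lra.
  by exists v => //; rewrite (le_trans vL)// ler_wpM2l// -lerBrDr.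
have : L * K * (s - a) * 2 <= K.
  rewrite -[leRHS]mul1r.
  apply: le_trans (ler_wpM2r K0 baL).
  have : L * (s - a) <= L * (b - a) by rewrite ler_wpM2l// lerB.
  by move=> /(ler_wpM2r K0); lra.
have := lerB_dist (z s) (z a).
by lra.
Qed.

(** Doubling on each of [N] short intervals replaces the exponential of the
    usual statement. *)
Lemma gronwall_iter (L h c rho : R) (N : nat) z a b : a <= b -> b - a <= N%:R * h ->
  h * L * 2 <= 1 -> 0 <= h -> 0 <= L -> 0 <= c -> abs_continuous_on a b z ->
  (\forall t \ae (@lebesgue_measure R), a < t < b -> `|z t| <= rho ->
     exists2 v, is_derive (t : R) (1 : R) z v & `|v| <= L * (`|z t| + c)) ->
  2 ^+ N * (`|z a| + c) < rho ->
  forall t, a <= t <= b -> `|z t| + c <= 2 ^+ N * (`|z a| + c).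
Proof.
move=> + + hL h0 L0 c0; elim: N a => [|N IH] a ab baN acz dz zarho t tab.
  have [-> _] : t = a /\ a = b by split; lra.
  by rewrite expr0 mul1r.
have za0 : 0 <= `|z a| + c by rewrite addr_ge0.
have p1 : 1 <= 2 ^+ N :> R by rewrite exprn_ege1// ler1n.
pose a' := Num.min b (a + h).
have aa' : a <= a' by rewrite /a' le_min ab lerDl.
have a'b : a' <= b by rewrite /a' ge_min lexx.
have st u : a <= u <= a' -> `|z u| + c <= 2 * (`|z a| + c).
  apply: (@gronwall_step z a a' L c rho) => //.
  - apply: le_trans hL; rewrite ler_wpM2r// ler_wpM2r// lerBlDl.
    by rewrite /a' ge_min lexx orbT.
  - exact: abs_continuous_sub acz.
  - apply: aeS dz => s ds /andP[au ua']; apply: ds.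
    by rewrite au (lt_le_trans ua').
  - apply: le_lt_trans zarho; rewrite exprS -mulrA ler_pM2l//.
    by rewrite ler_peMl.
have za' : 2 ^+ N * (`|z a'| + c) <= 2 ^+ N.+1 * (`|z a| + c).
  rewrite exprSr -mulrA ler_wpM2l ?exprn_ge0//; apply: st.
  by rewrite aa' lexx.
have [ta'|a't] := leP t a'.
  case/andP: tab => a_t tb.
  rewrite (le_trans (st t _)) ?a_t//.
  by rewrite exprS -mulrA ler_pM2l// ler_peMl.
apply: le_trans za'; apply: (IH a') => //.
- rewrite /a'; case: (leP b (a + h)) => _; first by rewrite subrr mulr_ge0.
  by move: baN; rewrite -natr1 mulrDl mul1r; lra.
- exact: abs_continuous_sub acz.
- apply: aeS dz => s ds /andP[au ua']; apply: ds.
  by rewrite ua' (le_lt_trans aa' au).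
- apply: le_lt_trans zarho.
  rewrite exprSr -mulrA ler_wpM2l ?exprn_ge0//; apply: st.
  by rewrite aa' lexx.
- by rewrite (ltW a't); case/andP: tab.
Qed.

Lemma gronwall (L A : R) : 0 <= L -> 0 <= A -> exists2 C : R, 1 <= C &
  forall z a b (c rho : R), a <= b -> b - a <= A ->
  0 <= c -> abs_continuous_on a b z ->
  (\forall t \ae (@lebesgue_measure R), a < t < b -> `|z t| <= rho ->
     exists2 v, is_derive (t : R) (1 : R) z v & `|v| <= L * (`|z t| + c)) ->
  C * (`|z a| + c) < rho ->
  forall t, a <= t <= b -> `|z t| + c <= C * (`|z a| + c).
Proof.
move=> L0 A0; pose h := (2 * (L + 1))^-1; pose N := (Num.truncn (A / h)).+1.
have h0 : 0 < h by rewrite invr_gt0 mulr_gt0// ltr_wpDl.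
exists (2 ^+ N); first by rewrite exprn_ege1// ler1n.
move=> z a b c rho ab bA c0 acz dz zarho t tab.
apply: (@gronwall_iter L h c rho N z a b) => //; last exact: ltW.
  rewrite (le_trans bA)// -ler_pdivrMr// ltW// /N.
  exact: truncnS_gt.
rewrite -mulrA mulrC /h ler_pdivrMr ?mulr_gt0 ?ltr_wpDl// mul1r.
by rewrite mulrC ler_pM2l// lerDl.
Qed.

End Gronwall.

(** * Lipschitz constants on bounded sets *)

Lemma subr_split (V : zmodType) (a b c d : V) :
  a - b = (c - d) - ((c - a) - (d - b)).
Proof. by rewrite opprB addrA subrKA opprB [RHS]addrC subrKA. Qed.

Section LipschitzOnBoxes.
Variables (R : realType) (n m : nat).

Lemma near_dist (V : normedModType R) (p : V) (d : R) : 0 < d ->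
  nbhs p [set q | `|p - q| < d].
Proof.
by move=> d0; have := nbhsx_ballx p d d0; rewrite -ball_normE.
Qed.

Lemma compact_norm_le k (M : R) : compact [set x : 'rV[R]_k | `|x| <= M].
Proof.
apply: bounded_closed_compact.
  exists M; split; first exact: num_real.
  by move=> M' MM' x /= xM; rewrite (le_trans xM)// ltW.
rewrite (_ : mkset _ = Num.norm @^-1` [set y : R | y <= M])//.
by apply: closed_comp; [move=> x _; exact: norm_continuous|exact: closed_le].
Qed.

Variable f : 'rV[R]_n -> 'rV[R]_m -> 'rV[R]_n.
Hypothesis f_lip : locally_lipschitz f.
Let F (q : 'rV[R]_n * 'rV[R]_m) := f q.1 q.2.

Lemma locally_lipschitz_near p (e : R) : 0 < e ->
  nbhs p [set q | `|F p - F q| < e].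
Proof.
move=> e0; have [U Up [M [_ MU]]] := f_lip p.
have C0 : 0 < Num.max M 0 + 1 by rewrite ltr_wpDl// le_max lexx orbT.
have {}MU q : U q -> `|F p - F q| <= (Num.max M 0 + 1) * `|p - q|.
  move=> Uq; apply: (MU (Num.max M 0 + 1) _ (p, q)); last first.
    by split=> //=; exact: nbhs_singleton.
  by rewrite ltr_pwDr// le_max lexx.
have d0 : 0 < e / (Num.max M 0 + 1) by rewrite divr_gt0.
apply: filterS (filterI Up (near_dist p d0)) => q [Uq /= pq].
by rewrite (le_lt_trans (MU q Uq))// mulrC -ltr_pdivlMr.
Qed.

(** Near a point of the diagonal, local Lipschitz continuity applies; near a
    pair of distinct points, the difference quotient is bounded. Compactness
    of the set of pairs in the box makes the constant uniform. *)
Lemma lipschitz_box (M : R) : exists2 L : R, 0 < L &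
  forall x y u v, `|x| <= M -> `|y| <= M -> `|u| <= M -> `|v| <= M ->
    `|f x u - f y v| <= L * Num.max `|x - y| `|u - v|.
Proof.
pose K := [set x : 'rV[R]_n | `|x| <= M] `*` [set u : 'rV[R]_m | `|u| <= M].
have cK : compact K by apply: compact_setX; exact: compact_norm_le.
have /compact_near_coveringP/(_ R +oo%R
  (fun L qq => `|F qq.1 - F qq.2| <= L * `|qq.1 - qq.2|)) := compact_setX cK cK.
case=> [[q q'] _|L [_ LK]] /=.
  have [<-|qq'] := eqVneq q q'.
    have [U Uq [M0 [_ M0U]]] := f_lip q.
    exists ((U `*` U), [set L | M0 < L]).
      split; first by exists (U, U).
      by exists M0; split => //; exact: num_real.
    by move=> [[p p'] L'] [[/= Up Up'] ML']; exact: (M0U _ ML' (p, p')).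
  pose d := `|q - q'| / 2; have d0 : 0 < d by rewrite divr_gt0// normr_gt0 subr_eq0.
  pose C := (`|F q - F q'| + 2) / d.
  pose B p := [set p' | `|p - p'| < d / 2] `&` [set p' | `|F p - F p'| < 1].
  have BP p : nbhs p (B p).
    apply: filterI; first by apply: near_dist; rewrite divr_gt0.
    exact: locally_lipschitz_near.
  exists (B q `*` B q', [set L | C < L]).
    split; first by exists (B q, B q').
    by exists C; split => //; exact: num_real.
  move=> [[p p'] L] [[/= [qp Fqp] [qp' Fqp']] CL] /=.
  have pp' : d <= `|p - p'|.
    rewrite (subr_split p p' q q').
    have := lerB_dist (q - q') ((q - p) - (q' - p')).
    have := ler_normB (q - p) (q' - p').
    have dE : `|q - q'| = 2 * d by rewrite /d mulrC divfK.
    by move: qp qp' => /=; rewrite dE; lra.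
  have FF : `|F p - F p'| <= `|F q - F q'| + 2.
    rewrite (subr_split (F p) (F p') (F q) (F q')).
    have := ler_normB (F q - F q') ((F q - F p) - (F q' - F p')).
    have := ler_normB (F q - F p) (F q' - F p').
    by move: Fqp Fqp' => /=; lra.
  rewrite (le_trans FF)//.
  have -> : `|F q - F q'| + 2 = C * d by rewrite /C divfK// gt_eqF.
  apply: le_trans (ler_wpM2r (ltW d0) (ltW CL)) _.
  by rewrite ler_wpM2l// (le_trans _ (ltW CL))// divr_ge0 ?addr_ge0 ?(ltW d0).
exists (Num.max L 0 + 1); first by rewrite ltr_wpDl// le_max lexx orbT.
move=> x y u v xM yM uM vM.
have /(_ _ ((x, u), (y, v))) := LK (Num.max L 0 + 1); apply => //.
by rewrite ltr_pwDr// le_max lexx.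
Qed.

End LipschitzOnBoxes.

(** * Translations and Lebesgue measurability *)

Section Translation.
Variable R : realType.
Implicit Types (A : set R) (c : R).

Lemma measurable_shift c : measurable_fun [set: measurableTypeR R]
  ((fun t => t + c) : measurableTypeR R -> measurableTypeR R).
Proof.
by apply: continuous_measurable_fun => x; apply: cvgD; [exact: cvg_id|exact: cvg_cst].
Qed.

Lemma lebesgue_measure_shift c (A : set (measurableTypeR R)) : measurable A ->
  lebesgue_measure [set t | A (t + c)] = lebesgue_measure A.
Proof.
move=> mA; have mf := measurable_shift c.
(* the measure structure of the image measure takes [mf] as an argument *)
pose mu : {measure set (measurableTypeR R) -> \bar R} :=
  measure_function_pushforward__canonical__measure_function_Measure
    (@lebesgue_measure R) mf.
apply/esym; apply: (lebesgue_measure_unique (mu := mu)) => //.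
move=> X /ocitvP[->|[[a b] /= ab ->]]; first by rewrite !measure0.
rewrite /mu/= /pushforward.
rewrite (_ : _ @^-1` _ = `]a - c, b - c]%classic); last first.
  by apply/seteqP; split=> t /=; rewrite !in_itv/= ltrBlDr lerBrDr.
rewrite (@lebesgue_measure_itv R `]a, b])/= (@lebesgue_measure_itv R `]a - c, b - c])/=.
rewrite !lte_fin ltrD2r; case: ifP => // _; congr (_%:E); by lra.
Qed.

Lemma negligible_shift c A : lebesgue_measure.-negligible A ->
  lebesgue_measure.-negligible [set t | A (t + c)].
Proof.
move=> [N [mN N0 AN]]; exists [set t | N (t + c)]; split.
- by have := measurable_shift c measurableT mN; rewrite setTI.
- by rewrite lebesgue_measure_shift.
- by move=> t /= /AN.
Qed.

Lemma ae_shift c (P : R -> Prop) :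
  (\forall t \ae (@lebesgue_measure R), P t) ->
  \forall t \ae (@lebesgue_measure R), P (t + c).
Proof. exact: negligible_shift. Qed.

Notation lebT := (g_sigma_algebraType (completed_algebra_gen (@lebesgue_measure R))).

(** Translations preserve Borel sets and null sets, hence the completed
    sigma-algebra. *)
Lemma lebesgue_measurable_shift c (A : set lebT) : measurable A ->
  measurable ([set t | A (t + c)] : set lebT).
Proof.
have mE (X : set lebT) :
    measurable X = completed_algebra_gen (@lebesgue_measure R) X.
  by have := congr1 (fun S => S X) (@g_sigma_completed_algebra_genE R).
rewrite !mE => -[B mB [N nN <-]].
exists [set t | B (t + c)].
  by have := measurable_shift c measurableT mB; rewrite setTI.
by exists [set t | N (t + c)] => //; exact: negligible_shift.
Qed.

Lemma lebesgue_measurable_itv (i : interval R) : measurable ([set` i] : set lebT).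
Proof.
apply: sub_sigma_algebra; exists [set` i]; first exact: measurable_itv.
by exists set0; [exact: negligible_set0|rewrite setU0].
Qed.

Variable m : nat.
Implicit Types u v : R -> 'rV[R]_m.

Lemma measurable_on_shift c D u : measurable_on D u ->
  measurable_on [set t | D (t + c)] (fun t => u (t + c)).
Proof.
move=> mu i mD Y mY.
have mD' : measurable (D : set lebT).
  have := lebesgue_measurable_shift (- c) mD.
  by congr measurable; apply/seteqP; split=> t /=; rewrite subrK.
by have := lebesgue_measurable_shift c (mu i mD' Y mY).
Qed.

Lemma measurable_on_sub (i : interval R) D u : D `<=` [set` i] -> measurable_on [set` i] u ->
  measurable_on D u.
Proof. by move=> Di mu j; exact: measurable_funS (lebesgue_measurable_itv i) Di (mu j). Qed.

Lemma measurable_on_cup (i j : interval R) u :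
  measurable_on [set` i] u -> measurable_on [set` j] u ->
  measurable_on ([set` i] `|` [set` j]) u.
Proof.
move=> mi mj k; apply/measurable_funU; try exact: lebesgue_measurable_itv.
by split; [exact: mi|exact: mj].
Qed.

Lemma measurable_on_bigcup (E : nat -> interval R) u :
  (forall i, measurable_on [set` E i] u) -> measurable_on (\bigcup_i [set` E i]) u.
Proof.
move=> mE k; apply/measurable_fun_bigcup => i; first exact: lebesgue_measurable_itv.
exact: mE.
Qed.

Lemma eq_measurable_on D u v : (forall t, D t -> u t = v t) ->
  measurable_on D u -> measurable_on D v.
Proof.
by move=> uv mu k; apply: eq_measurable_fun (mu k) => t /set_mem Dt; rewrite uv.
Qed.

Lemma measurable_on_const D (x : 'rV[R]_m) : measurable_on D (fun=> x).
Proof. by move=> k; exact: measurable_cst. Qed.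

End Translation.

(** * Solutions on compact intervals: stability and uniqueness *)

Section AbsContinuous.
Variables (R : realType) (n : nat).
Implicit Types (x y z : R -> 'rV[R]_n) (a b c : R).

Lemma abs_continuousB x y a b : abs_continuous_on a b x ->
  abs_continuous_on a b y -> abs_continuous_on a b (x - y).
Proof.
move=> acx acy e e0; pose e' := e / (2 * n.+1%:R).
have n0 : 0 < n.+1%:R :> R by rewrite ltr0n.
have e'0 : 0 < e' by rewrite divr_gt0// mulr_gt0.
have [dx dx0 xd] := acx e' e'0; have [dy dy0 yd] := acy e' e'0.
exists (Num.min dx dy); first by rewrite lt_min dx0.
move=> N s t st triv; rewrite lt_min => /andP[sdx sdy].
have := xd N s t st triv sdx; have := yd N s t st triv sdy.
set X := \sum_(i < N) enorm (x (t i) - x (s i)).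
set Y := \sum_(i < N) enorm (y (t i) - y (s i)) => Ye Xe.
apply: (@le_lt_trans _ _ (n.+1%:R * (X + Y))).
  rewrite -big_split/= mulr_sumr; apply: ler_sum => i _.
  apply: le_trans (enorm_le_norm _) _.
  apply: (@le_trans _ _ (n.+1%:R * `|(x - y) (t i) - (x - y) (s i)|)).
    by rewrite ler_wpM2r// ler_nat.
  rewrite ler_wpM2l//.
  have -> : (x - y) (t i) - (x - y) (s i) = (x (t i) - x (s i)) - (y (t i) - y (s i)).
    by rewrite !fctE !opprD !opprK addrACA.
  by rewrite (le_trans (ler_normB _ _))// lerD// norm_le_enorm.
have -> : e = n.+1%:R * (e' + e').
  by rewrite /e'; field; rewrite nat1r pnatr_eq0.
by rewrite ltr_pM2l// ltrD.
Qed.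

Lemma abs_continuous_shift x a b c : abs_continuous_on a b x ->
  abs_continuous_on (a - c) (b - c) (fun t => x (t + c)).
Proof.
move=> acx e e0; have [d d0 xd] := acx e e0; exists d => // N s t st triv sd.
apply: (xd N (fun i => s i + c) (fun i => t i + c)).
- by move=> i; have [h1 h2 h3] := st i; split; lra.
- move=> i j _ _ [w [/= wi wj]]; apply: triv => //; exists (w - c); move: wi wj.
  by rewrite /= !in_itv/= => /andP[h1 h2] /andP[h3 h4]; split; apply/andP; split; lra.
- by under eq_bigr do rewrite opprD addrACA subrr addr0.
Qed.

Lemma eq_abs_continuous x y a b : (forall t, a <= t <= b -> x t = y t) ->
  abs_continuous_on a b x -> abs_continuous_on a b y.
Proof.
move=> xy acx e e0; have [d d0 xd] := acx e e0; exists d => // N s t st triv sd.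
have := xd N s t st triv sd; rewrite (eq_bigr (fun i => enorm (y (t i) - y (s i))))//.
by move=> i _; have [h1 h2 h3] := st i; rewrite !xy//; apply/andP; split; lra.
Qed.

Lemma dist_within_continuous (V : normedModType R) (phi : R -> V) a b :
  (forall t, a <= t <= b -> forall e : R, 0 < e -> exists2 d : R, 0 < d &
     forall s, a <= s <= b -> `|s - t| < d -> `|phi s - phi t| < e) ->
  {within `[a, b], continuous phi}.
Proof.
move=> phic; apply/subspace_continuousP => t /=; rewrite in_itv/= => tab.
apply/cvgrPdist_lt => e e0; have [d d0 td] := phic t tab e e0.
rewrite /within/=; near_simpl; exists d => // s /= std.
by rewrite in_itv/= => sab; rewrite distrC; apply: td => //; rewrite distrC.
Qed.

Lemma abs_continuous_bounded x a b : a <= b -> abs_continuous_on a b x ->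
  exists2 M : R, 0 <= M & forall t, a <= t <= b -> `|x t| <= M.
Proof.
move=> ab acx.
have [c _ cM] := EVT_max ab (dist_within_continuous (abs_continuous_norm acx)).
by exists `|x c| => // t tab; apply: cM; rewrite in_itv.
Qed.

End AbsContinuous.

Section Solutions.
Variables (R : realType) (n m : nat).
Variable f : 'rV[R]_n -> 'rV[R]_m -> 'rV[R]_n.
Implicit Types (x y z : R -> 'rV[R]_n) (u v w : R -> 'rV[R]_m) (a b c : R).

(** A solution on the interval from [a] to [b] of the system driven by the
    input [v]. *)
Definition solution v a b x := abs_continuous_on a b x /\
  \forall t \ae (@lebesgue_measure R),
    a < t < b -> is_derive (t : R) (1 : R) x (f (x t) (v t)).

Lemma ode_solutionW v (I : set R) a b x : a <= b -> `[a, b] `<=` I ->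
  ode_solution (fun t p => f p (v t)) I x -> solution v a b x.
Proof.
move=> ab abI [acx dx]; split; first exact: acx.
apply: aeS dx => t dx tab; apply: dx.
have : `]a, b[%classic `<=` I.
  by move=> s /= /subset_itv_oo_cc; exact: abI.
by rewrite open_subsetE; [apply; rewrite /= in_itv|exact: interval_open].
Qed.

Lemma solution_ode v a b x :
  solution v a b x -> ode_solution (fun t p => f p (v t)) `[a, b] x.
Proof.
move=> [acx dx]; split.
  move=> a' b' a'b' sub.
  have /andP[h1 _] : a <= a' <= b.
    by have := sub a'; rewrite /= !in_itv/= lexx a'b'; apply.
  have /andP[_ h2] : a <= b' <= b.
    by have := sub b'; rewrite /= !in_itv/= lexx a'b'; apply.
  exact: abs_continuous_sub acx.
by apply: aeS dx => t dx; rewrite interior_itv/= in_itv/=; exact: dx.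
Qed.

Lemma is_derive_shift x (t c : R) (d : 'rV[R]_n) :
  is_derive (t + c) (1 : R) x d -> is_derive t (1 : R) (fun s => x (s + c)) d.
Proof.
have E : (fun h : R => h^-1 *: (((fun s => x (s + c)) \o shift t) (h *: (1 : R)) - x (t + c))) =
         (fun h : R => h^-1 *: ((x \o shift (t + c)) (h *: (1 : R)) - x (t + c))).
  by apply/funext => h; rewrite /= /shift/= addrA.
move=> [dx xd]; split; first by rewrite /derivable E.
by rewrite /derive E.
Qed.

Lemma solution_shift v a b c x : solution v a b x ->
  solution (fun t => v (t + c)) (a - c) (b - c) (fun t => x (t + c)).
Proof.
move=> [acx dx]; split; first exact: abs_continuous_shift.
apply: aeS (ae_shift c dx) => t dxt tab; apply: is_derive_shift.
by apply: dxt; case/andP: tab => h1 h2; apply/andP; split; lra.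
Qed.

Lemma solution_sub v a b a' b' x : a <= a' -> b' <= b ->
  solution v a b x -> solution v a' b' x.
Proof.
move=> aa' b'b [acx dx]; split; first exact: abs_continuous_sub acx.
apply: aeS dx => t dx /andP[h1 h2]; apply: dx.
by rewrite (le_lt_trans aa' h1) (lt_le_trans h2).
Qed.

Lemma eq_solution_input v w a b x : (forall t, a < t < b -> v t = w t) ->
  solution v a b x -> solution w a b x.
Proof.
move=> vw [acx dx]; split=> //; apply: aeS dx => t dx tab.
by rewrite -vw//; exact: dx.
Qed.

Hypothesis f_lip : locally_lipschitz f.

(** While [x] stays at distance at most [1] from [y], both remain in a box
    where [f] is Lipschitz, so their difference satisfies the hypothesis of
    the Gronwall estimate with [c = 0] and [rho = 1]. *)
Lemma solutionB v a b x y (M L : R) :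
  (forall (x y : 'rV[R]_n) (u v : 'rV[R]_m),
    `|x| <= M + 1 -> `|y| <= M + 1 -> `|u| <= M + 1 ->
    `|v| <= M + 1 -> `|f x u - f y v| <= L * Num.max `|x - y| `|u - v|) ->
  solution v a b x -> solution v a b y ->
  (forall t, a < t < b -> `|v t| <= M) -> (forall t, a <= t <= b -> `|y t| <= M) ->
  abs_continuous_on a b (x - y) /\
  \forall t \ae (@lebesgue_measure R), a < t < b -> `|(x - y) t| <= 1 ->
     exists2 d, is_derive (t : R) (1 : R) (x - y) d & `|d| <= L * (`|(x - y) t| + 0).
Proof.
move=> lipL [acx dx] [acy dy] vM yM; split; first exact: abs_continuousB.
apply: aeS (aeI dx dy) => t [dxt dyt] tab xy1.
exists (f (x t) (v t) - f (y t) (v t)); first exact: is_deriveB (dxt tab) (dyt tab).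
have tab' : a <= t <= b by case/andP: tab => h1 h2; rewrite !ltW.
have M1 : M <= M + 1 by rewrite lerDl.
have := lipL (x t) (y t) (v t) (v t).
rewrite subrr normr0 addr0 (max_idPl (normr_ge0 _)); apply.
- rewrite -(subrK (y t) (x t)) (le_trans (ler_normD _ _))// addrC lerD//; exact: yM.
- exact: le_trans (yM _ tab') M1.
- exact: le_trans (vM _ tab) M1.
- exact: le_trans (vM _ tab) M1.
Qed.

(** The Gronwall estimate is self-supporting: it keeps [x] within distance [1]
    of [y], where the Lipschitz constant that it uses is valid. *)
Lemma solution_stable (M A : R) : 0 <= A -> exists2 C : R, 1 <= C &
  forall v a b x y, a <= b -> b - a <= A ->
  solution v a b x -> solution v a b y ->
  (forall t, a < t < b -> `|v t| <= M) -> (forall t, a <= t <= b -> `|y t| <= M) ->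
  C * `|x a - y a| < 1 ->
  forall t, a <= t <= b -> `|x t - y t| <= C * `|x a - y a|.
Proof.
move=> A0; have [L L0 lipL] := lipschitz_box f_lip (M + 1).
have [C C1 gC] := @gronwall R n L A (ltW L0) A0; exists C => //.
move=> v a b x y ab bA sx sy vM yM xy1 t tab.
have [acz dz] := solutionB lipL sx sy vM yM.
have xy1' : C * (`|(x - y) a| + 0) < 1 by rewrite addr0.
by have := gC _ a b 0 1 ab bA (lexx 0) acz dz xy1' t tab; rewrite !addr0.
Qed.

Lemma solution_unique v a b x y (M : R) : solution v a b x -> solution v a b y ->
  (forall t, a < t < b -> `|v t| <= M) -> x a = y a ->
  forall t, a <= t <= b -> x t = y t.
Proof.
move=> sx sy vM xya t tab; have ab : a <= b by case/andP: tab; exact: le_trans.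
have [My _ yM] := abs_continuous_bounded ab sy.1.
have ba0 : 0 <= b - a by rewrite subr_ge0.
have [C C1] := solution_stable (Num.max M My) ba0.
move/(_ v a b x y ab (lexx _) sx sy); rewrite xya subrr normr0 mulr0 => st.
apply/eqP; rewrite -subr_eq0 -normr_le0; apply: st => // s sab.
  by rewrite le_max vM.
by rewrite le_max yM ?orbT.
Qed.

(** The derivative of [x - y] is at most [L] times [2 * `|x a - y a|]; over a
    time of [1 / (4 * L)], the mean value inequality gives the factor one
    half. *)
Lemma solution_contract (M : R) : exists2 h : R, 0 < h &
  forall v a b x y, a <= b -> b - a <= h ->
  solution v a b x -> solution v a b y ->
  (forall t, a < t < b -> `|v t| <= M) -> (forall t, a <= t <= b -> `|y t| <= M) ->
  2 * `|x a - y a| < 1 ->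
  `|(x b - y b) - (x a - y a)| <= 2^-1 * `|x a - y a|.
Proof.
have [L L0 lipL] := lipschitz_box f_lip (M + 1).
have L40 : 0 < 4 * L by rewrite mulr_gt0.
exists (4 * L)^-1; first by rewrite invr_gt0.
move=> v a b x y ab bh sx sy vM yM xy1.
have [acz dz] := solutionB lipL sx sy vM yM.
have bL : (b - a) * (4 * L) <= 1 by rewrite -ler_pdivlMr// mul1r.
have ba0 : 0 <= b - a by rewrite subr_ge0.
have bL0 : 0 <= (b - a) * L by rewrite mulr_ge0// ltW.
have zb := @gronwall_step R n (x - y) a b L 0 1 ab _ (ltW L0) (lexx 0) acz dz.
have {}zb t : a <= t <= b -> `|(x - y) t| <= 2 * `|x a - y a|.
  have xy1' : 2 * (`|(x - y) a| + 0) < 1 by rewrite addr0.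
  by move=> tab; have := zb _ xy1' t tab; rewrite !addr0; apply; lra.
have L0' := ltW L0; have xa0 : 0 <= `|x a - y a| by [].
have : `|(x - y) b - (x - y) a| <= L * (2 * `|x a - y a|) * (b - a).
  apply: mean_value ab _ acz _; first by rewrite !mulr_ge0.
  apply: aeS dz => t dz tab.
  have zt : `|(x - y) t| <= 2 * `|x a - y a|.
    by apply: zb; case/andP: tab => h1 h2; rewrite !ltW.
  case: dz => [//||d zd dL]; first by rewrite (le_trans zt)// ltW.
  by exists d => //; rewrite (le_trans dL)// addr0 ler_wpM2l.
move=> /le_trans; apply.
have -> : L * (2 * `|x a - y a|) * (b - a) = 2^-1 * ((b - a) * (4 * L)) * `|x a - y a| by field.
by rewrite ler_wpM2r// ler_piMr.
Qed.

End Solutions.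

(** * The flow of a forward complete system *)

HB.instance Definition _ (R : realType) n := Complete.on 'rV[R]_n.

Section Flow.
Variables (R : realType) (n m : nat).
Variable f : 'rV[R]_n -> 'rV[R]_m -> 'rV[R]_n.
Hypothesis f_lip : locally_lipschitz f.
Hypothesis f_fc : forward_complete f.
Implicit Types (p q : 'rV[R]_n) (u v w : R -> 'rV[R]_m).

(** The inputs to which forward completeness applies, with boundedness
    expressed in the maximum norm. *)
Definition input u := measurable_on `[0, +oo[ u /\
  forall b : R, exists M : R, forall t, 0 <= t <= b -> `|u t| <= M.

(** The choice among solutions is immaterial, by [flow_unique]. *)
Definition flow p u : R -> 'rV[R]_n :=
  xget (fun=> 0) [set x | ode_solution (fun t q => f q (u t)) `[0, +oo[ x /\ x 0 = p].

Lemma flow_ode p u : input u ->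
  ode_solution (fun t q => f q (u t)) `[0, +oo[ (flow p u) /\ flow p u 0 = p.
Proof.
move=> [mu bu]; apply: (@xgetPex _ (fun=> 0)
  [set x | ode_solution (fun t q => f q (u t)) `[0, +oo[ x /\ x 0 = p]).
apply: f_fc => // b; have [M uM] := bu b; exists (m%:R * M) => t /=.
rewrite in_itv/= => tb; rewrite (le_trans (enorm_le_norm _))// ler_wpM2l//.
exact: uM.
Qed.

Lemma flow0 p u : input u -> flow p u 0 = p.
Proof. by move=> /(flow_ode p)[]. Qed.

Lemma flow_solution p u (b : R) : input u -> 0 <= b -> solution f u 0 b (flow p u).
Proof.
move=> iu b0; apply: ode_solutionW b0 _ (flow_ode p iu).1.
by move=> t /=; rewrite !in_itv/= => /andP[->].
Qed.

Lemma flow_unique u (b : R) x : input u -> solution f u 0 b x ->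
  forall t, 0 <= t <= b -> x t = flow (x 0) u t.
Proof.
move=> iu sx t tb; have b0 : 0 <= b by case/andP: tb; exact: le_trans.
have [M uM] := iu.2 b.
apply: (solution_unique (M := M) f_lip sx (flow_solution (x 0) iu b0) _ _ tb).
  by move=> s /andP[s0 sb]; apply: uM; rewrite !ltW.
by rewrite flow0.
Qed.

Lemma flow_causal p u v (b : R) : input u -> input v ->
  (forall t, 0 < t < b -> u t = v t) ->
  forall t, 0 <= t <= b -> flow p u t = flow p v t.
Proof.
move=> iu iv uv t tb; have b0 : 0 <= b by case/andP: tb; exact: le_trans.
have su := eq_solution_input uv (flow_solution p iu b0).
by rewrite (flow_unique iv su tb) flow0.
Qed.

Lemma input_shift u (c : R) : 0 <= c -> input u -> input (fun t => u (t + c)).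
Proof.
move=> c0 [mu bu]; split.
  have := measurable_on_shift (c := c) mu.
  rewrite (_ : mkset _ = `[- c, +oo[%classic).
    by apply: measurable_on_sub => t /=; rewrite !in_itv/= !andbT; lra.
  by apply/seteqP; split=> t /=; rewrite !in_itv/= !andbT; lra.
move=> b; have [M uM] := bu (b + c); exists M => t /andP[t0 tb]; apply: uM.
by rewrite addr_ge0// lerD2r.
Qed.

Lemma flow_shift p u (s t : R) : input u -> 0 <= s -> 0 <= t ->
  flow p u (t + s) = flow (flow p u s) (fun r => u (r + s)) t.
Proof.
move=> iu s0 t0.
have ts0 : 0 <= t + s by rewrite addr_ge0.
have := solution_shift s (solution_sub s0 (lexx _) (flow_solution p iu ts0)).
rewrite subrr addrK => sx; have := flow_unique (input_shift s0 iu) sx (t := t).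
by rewrite t0 lexx add0r => /(_ isT).
Qed.

Lemma flow_bounded p u (b : R) : input u -> 0 <= b -> exists M : R,
  [/\ 0 <= M, forall t, 0 <= t <= b -> `|flow p u t| <= M &
    forall t, 0 <= t <= b -> `|u t| <= M].
Proof.
move=> iu b0; have [Mu uM] := iu.2 b.
have [Mx Mx0 xM] := abs_continuous_bounded b0 (flow_solution p iu b0).1.
exists (Num.max Mx Mu); split=> [|t tb|t tb]; rewrite le_max ?Mx0//.
  by rewrite xM.
by rewrite uM ?orbT.
Qed.

Lemma flow_continuous p u (t : R) : input u -> 0 <= t ->
  forall e : R, 0 < e -> exists2 d : R, 0 < d &
    forall q, `|q - p| <= d -> `|flow q u t - flow p u t| <= e.
Proof.
move=> iu t0 e e0; have [M [M0 xM uM]] := flow_bounded p iu t0.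
have [C C1 stable] := @solution_stable _ _ _ f f_lip M t t0.
have C0 : 0 < C := lt_le_trans ltr01 C1.
pose d := Num.min e 2^-1 / C.
have m0 : 0 < Num.min e 2^-1 by rewrite lt_min e0/= invr_gt0.
have Cd : C * d = Num.min e 2^-1 by rewrite /d mulrCA mulfV ?gt_eqF// mulr1.
exists d => [|q qp]; first by rewrite divr_gt0.
have Cqp : C * `|q - p| <= Num.min e 2^-1 by rewrite -Cd ler_pM2l.
have := @stable u 0 t (flow q u) (flow p u) t0.
rewrite subr0 lexx !flow0// => /(_ isT); move=> /(_ _ _ _ _ _ t) h.
apply: (@le_trans _ _ (C * `|q - p|)); last by rewrite (le_trans Cqp)// ge_min lexx.
apply: h; rewrite ?t0 ?lexx//; try exact: flow_solution.
  by move=> s /andP[s0 st]; apply: uM; rewrite !ltW.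
by rewrite (le_lt_trans Cqp)// gt_min invf_lt1 ?ltr1n ?orbT.
Qed.

(** The flow over a short time is a perturbation of the identity by a
    contraction, so it is onto a neighbourhood by the Banach fixed point
    theorem. *)
Lemma flow_open_short (M : R) : 0 <= M -> exists2 h : R, 0 < h &
  forall e : R, 0 < e -> exists2 d : R, 0 < d &
    forall p u (t : R), input u -> 0 <= t -> t <= h ->
    (forall s, 0 <= s <= t -> `|flow p u s| <= M) ->
    (forall s, 0 <= s <= t -> `|u s| <= M) ->
    forall q, `|q - flow p u t| <= d -> exists2 p', `|p' - p| <= e & flow p' u t = q.
Proof.
move=> M0; have [h h0 contr] := solution_contract f_lip (M + 1).
exists h => // e e0.
have [C C1 stable] := @solution_stable _ _ _ f f_lip M h (ltW h0).
have C0 : 0 < C := lt_le_trans ltr01 C1.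
have C80 : 0 < 8 * C by rewrite mulr_gt0.
(* trajectories starting within [r] of [p] stay within [1] of that of [p] *)
pose r := Num.min e (8 * C)^-1.
have r0 : 0 < r by rewrite lt_min e0 invr_gt0.
have Cr : C * r <= 8^-1.
  have : C * r <= C * (8 * C)^-1 by rewrite ler_pM2l// ge_min lexx orbT.
  by move/le_trans; apply; rewrite invfM mulrCA mulfV ?mulr1// gt_eqF.
have r8 : r <= 8^-1 by apply: le_trans Cr; rewrite ler_peMl// ltW.
exists (r / 2) => [|p u t iu t0 th xM uM q qp]; first by rewrite divr_gt0.
pose U := [set x | `|x - p| <= r].
have Up : U p by rewrite /U/= subrr normr0 ltW.
have tt : 0 <= t <= t by rewrite t0 lexx.
have u_lt s : 0 < s < t -> `|u s| <= M.
  by case/andP=> s0 st; apply: uM; rewrite !ltW.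
have near x : U x -> forall s, 0 <= s <= t -> `|flow x u s| <= M + 1.
  move=> Ux s st.
  have := @stable u 0 t (flow x u) (flow p u) t0.
  rewrite subr0 !flow0// => /(_ th (flow_solution _ iu t0) (flow_solution _ iu t0) u_lt xM).
  have Cxp : C * `|x - p| <= 8^-1 by apply: le_trans Cr; rewrite ler_pM2l.
  have lt1 : C * `|x - p| < 1 by rewrite (le_lt_trans Cxp)// invf_lt1// ltr1n.
  move=> /(_ lt1 s st) hs.
  rewrite -(subrK (flow p u s) (flow x u s)) (le_trans (ler_normD _ _))// addrC lerD//.
    exact: xM.
  by rewrite (le_trans hs)// ltW.
have contrU x y : U x -> U y ->
    `|(flow x u t - flow y u t) - (x - y)| <= 2^-1 * `|x - y|.
  move=> Ux Uy; have := @contr u 0 t (flow x u) (flow y u) t0.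
  rewrite subr0 !flow0//; apply=> //; try exact: flow_solution.
  - by move=> s /u_lt us; rewrite (le_trans us)// lerDl.
  - exact: near.
  - have : `|x - y| <= r + r.
      rewrite -(subrKA p) (le_trans (ler_normD _ _))// lerD//.
      by rewrite distrC.
    by lra.
(* a fixed point of [G] is an initial state that is steered to [q] *)
pose G x := q - (flow x u t - x).
have GU : set_fun U U G.
  move=> x Ux; rewrite /U/= /G.
  have -> : q - (flow x u t - x) - p =
      (q - flow p u t) - ((flow x u t - flow p u t) - (x - p)).
    rewrite !opprB; apply/matrixP => i j; rewrite !mxE; lra.
  rewrite (le_trans (ler_normB _ _))//.
  have := contrU x p Ux Up; move: Ux; rewrite /U/=; lra.
have ctrG : is_contraction (mkfun_fun GU).
  have h2 : 0 <= 2^-1 :> R by rewrite invr_ge0.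
  exists (NngNum h2); split=> /=; first by rewrite invf_lt1// ltr1n.
  move=> [x y] [/= Ux Uy]; rewrite /mkfun /G.
  have -> : q - (flow x u t - x) - (q - (flow y u t - y)) =
      - ((flow x u t - flow y u t) - (x - y)).
    by apply/matrixP => i j; rewrite !mxE; lra.
  by rewrite normrN; exact: contrU.
have clU : closed U.
  move=> x Ux; apply/ler_addgt0Pr => e' e'0.
  have [y [Uy /= xy]] := Ux _ (near_dist x e'0).
  rewrite -(subrKA y) addrC (le_trans (ler_normD _ _))// lerD//; exact: ltW.
have [p' Up' p'G] := banach_fixed_point ctrG clU (ex_intro _ p Up).
exists p'; first by rewrite (le_trans Up')// ge_min lexx.
move: p'G; rewrite /= /mkfun /G => /eqP.
rewrite opprB addrCA -[X in X == _]addr0 (inj_eq (addrI _)) eq_sym subr_eq0.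
by move=> /eqP.
Qed.

(** Openness over a longer time follows by chaining short times along the
    trajectory; the radius depends only on bounds for the data. *)
Lemma flow_open_unif (M A : R) : 0 <= M -> 0 <= A ->
  forall e : R, 0 < e -> exists2 d : R, 0 < d &
    forall p u (t : R), input u -> 0 <= t <= A ->
    (forall s, 0 <= s <= t -> `|flow p u s| <= M) ->
    (forall s, 0 <= s <= t -> `|u s| <= M) ->
    forall q, `|q - flow p u t| <= d -> exists2 p', `|p' - p| <= e & flow p' u t = q.
Proof.
move=> M0 A0; have [h h0 short] := flow_open_short M0.
suff H N : forall e : R, 0 < e -> exists2 d : R, 0 < d &
    forall p u (t : R), input u -> 0 <= t -> t <= N%:R * h ->
    (forall s, 0 <= s <= t -> `|flow p u s| <= M) ->
    (forall s, 0 <= s <= t -> `|u s| <= M) ->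
    forall q, `|q - flow p u t| <= d -> exists2 p', `|p' - p| <= e & flow p' u t = q.
  move=> e e0; have [d d0 od] := H (Num.truncn (A / h)).+1 e e0.
  exists d => // p u t iu /andP[t0 tA]; apply: od => //.
  by rewrite (le_trans tA)// -ler_pdivrMr// ltW// truncnS_gt.
elim: N => [|N IH] e e0.
  exists e => // p u t iu t0; rewrite mul0r => t0' _ _ q.
  have -> : t = 0 by lra.
  by rewrite flow0// => qp; exists q => //; rewrite flow0.
have [d d0 open1] := IH e e0; have [d' d'0 open2] := short d d0.
exists d' => // p u s iu s0 sN xM uM q.
pose s1 := Num.max 0 (s - h).
have s10 : 0 <= s1 by rewrite le_max lexx.
have s1s : s1 <= s by rewrite ge_max s0 gerBl ltW.
have ss1 : 0 <= s - s1 by rewrite subr_ge0.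
have sh : s - s1 <= h by rewrite lerBlDl -lerBlDr le_max lexx orbT.
have s1N : s1 <= N%:R * h.
  rewrite ge_max mulr_ge0 ?(ltW h0)//= lerBlDr.
  by move: sN; rewrite -natr1 mulrDl mul1r.
have fs x r : 0 <= r -> flow x u (r + s1) = flow (flow x u s1) (fun r => u (r + s1)) r.
  by move=> r0; exact: flow_shift.
have x1M r : 0 <= r <= s - s1 ->
    `|flow (flow p u s1) (fun r => u (r + s1)) r| <= M.
  by move=> /andP[r0 rs]; rewrite -fs//; apply: xM; rewrite addr_ge0//=; lra.
have u1M r : 0 <= r <= s - s1 -> `|u (r + s1)| <= M.
  by move=> /andP[r0 rs]; apply: uM; rewrite addr_ge0//=; lra.
rewrite -{1}(subrK s1 s) fs//.
move=> /(open2 _ _ _ (input_shift s10 iu) ss1 sh x1M u1M)[p1 p1d p1q].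
have [||p' p'e p'1] := open1 p u s1 iu s10 s1N _ _ p1 p1d.
- by move=> r /andP[r0 rs]; apply: xM; rewrite r0 (le_trans rs).
- by move=> r /andP[r0 rs]; apply: uM; rewrite r0 (le_trans rs).
by exists p' => //; rewrite -(subrK s1 s) fs// p'1.
Qed.

Lemma flow_open p u (t : R) : input u -> 0 <= t ->
  forall e : R, 0 < e -> exists2 d : R, 0 < d &
    forall q, `|q - flow p u t| <= d -> exists2 p', `|p' - p| <= e & flow p' u t = q.
Proof.
move=> iu t0 e e0; have [M [M0 xM uM]] := flow_bounded p iu t0.
have [d d0 open] := flow_open_unif M0 t0 e0; exists d => //.
by apply: open => //; rewrite t0 lexx.
Qed.

End Flow.

(** * Boundedness of reachable sets *)

Lemma compact_seq_cluster (X : topologicalType) (K : set X) (s : nat -> X) :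
  compact K -> (forall i, K (s i)) ->
  exists2 x, K x & forall V N, nbhs x V -> exists2 i, (N <= i)%N & V (s i).
Proof.
move=> cK Ks; have sK : (s @ \oo) K.
  by exists 0%N => // i _; exact: Ks.
have [x [Kx clx]] := cK _ _ sK.
exists x => // V N xV.
have [|_ [[i /= Ni <-] Vi]] := clx (s @` [set i | (N <= i)%N]) V _ xV; last by exists i.
by exists N => // i /= Ni; exists i.
Qed.

Section BoundedReachability.
Variables (R : realType) (n m : nat).
Variable f : 'rV[R]_n -> 'rV[R]_m -> 'rV[R]_n.
Hypothesis f_lip : locally_lipschitz f.
Hypothesis f_fc : forward_complete f.
Implicit Types (p q : 'rV[R]_n) (u v w : R -> 'rV[R]_m).
Notation flow := (flow f).

Definition input_concat u (s : R) v : R -> 'rV[R]_m :=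
  fun t => if t < s then u t else v (t - s).

Lemma input_concat_input u v (s : R) : 0 <= s -> input u -> input v ->
  input (input_concat u s v).
Proof.
move=> s0 [mu bu] [mv bv]; split.
  have -> : `[0, +oo[%classic = `[0, s[%classic `|` `[s, +oo[%classic :> set R.
    by rewrite -itv_bndbnd_setU.
  apply: measurable_on_cup.
    apply: eq_measurable_on (measurable_on_sub _ mu).
      by move=> t /=; rewrite in_itv/= /input_concat => /andP[_ ->].
    by move=> t /=; rewrite !in_itv/= => /andP[->].
  apply: (eq_measurable_on (u := fun t => v (t - s))).
    by move=> t /=; rewrite in_itv/= andbT /input_concat ltNge => ->.
  have := measurable_on_shift (c := - s) mv.
  congr measurable_on; apply/seteqP; split=> t /=; rewrite !in_itv/= !andbT; lra.
move=> b; have [Mu uM] := bu b; have [Mv vM] := bv b.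
exists (Num.max Mu Mv) => t /andP[t0 tb]; rewrite /input_concat le_max.
have [ts|st] := ltP t s; first by rewrite uM// t0.
rewrite vM ?orbT// subr_ge0 st/=; lra.
Qed.

Lemma flow_concat p u v (s t : R) : 0 <= s -> 0 <= t -> input u -> input v ->
  flow p (input_concat u s v) (t + s) = flow (flow p u s) v t.
Proof.
move=> s0 t0 iu iv; have iw := input_concat_input s0 iu iv.
rewrite (flow_shift f_lip f_fc)//.
have -> : flow p (input_concat u s v) s = flow p u s.
  apply: (flow_causal f_lip f_fc p (b := s)) => //; last by rewrite s0 lexx.
  by move=> r /andP[_ rs]; rewrite /input_concat rs.
apply: (flow_causal f_lip f_fc _ (b := t)) => //.
- exact: input_shift.
- move=> r /andP[r0 _]; rewrite /input_concat ltNge lerDr (ltW r0)/=.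
  by rewrite addrK.
- by rewrite t0 lexx.
Qed.

Variable M : R.
Hypothesis M0 : 0 <= M.

Definition admissible u := input u /\ forall t, 0 <= t -> `|u t| <= M.

(** Blow-up within time [th] from around [p]. The slack [e], both in the
    initial state and in time, makes the property stable under limits. *)
Definition blows_up p (th : R) := forall e B : R, 0 < e -> exists q u t,
  [/\ admissible u, `|q - p| <= e, 0 <= t <= th + e & B < `|flow q u t| ].

Lemma admissible_concat u v (s : R) : 0 <= s -> admissible u -> admissible v ->
  admissible (input_concat u s v).
Proof.
move=> s0 [iu uM] [iv vM]; split; first exact: input_concat_input.
move=> t t0; rewrite /input_concat; case: ltP => st; first exact: uM.
by apply: vM; rewrite subr_ge0.
Qed.

Lemma admissible_shift u (s : R) : 0 <= s -> admissible u ->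
  admissible (fun t => u (t + s)).
Proof.
move=> s0 [iu uM]; split; first exact: input_shift.
by move=> t t0; apply: uM; rewrite addr_ge0.
Qed.

Lemma blows_up_ge0 p th : blows_up p th -> 0 <= th.
Proof.
move=> bad; apply/ler_addgt0Pr => e e0.
by have [q [u [t [_ _ /andP[t0 tth] _]]]] := bad e 0 e0; exact: le_trans tth.
Qed.

(** Trajectories that become large from near [p] all cross the sphere of
    radius [r]. Their crossing points and crossing times accumulate at some
    [p'] and [s'], and the parts of the trajectories after the crossings show
    that [p'] blows up within the remaining time [th - s']. Crossing points
    come arbitrarily close to [p'] along trajectories that obey a common bound,
    so the uniform openness of the flow provides a trajectory that starts near
    [p] and passes exactly through [p']. *)
Lemma blows_up_step p th (B : R) : blows_up p th ->
  exists p' th', [/\ blows_up p' th', B <= `|p'| &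
    forall e : R, 0 < e -> exists q u s, [/\ admissible u, `|q - p| <= e,
      0 <= s, s <= th - th' + e & flow q u s = p']].
Proof.
move=> bad; have th0 := blows_up_ge0 bad.
pose r := Num.max B (`|p| + 2).
have rp : `|p| + 2 <= r by rewrite le_max lexx orbT.
have r0 : 0 <= r by rewrite (le_trans _ rp)// addr_ge0.
have cross (N : nat) : exists a : R * R * (R -> 'rV[R]_m) * 'rV[R]_n,
    let: (t, s, u, q) := a in
    [/\ admissible u, `|q - p| <= N.+1%:R^-1, 0 <= s <= t, t <= th + N.+1%:R^-1 &
     [/\ N%:R < `|flow q u t|, `|flow q u s| = r &
      forall z : R, 0 <= z <= s -> `|flow q u z| <= r]].
  have N0 : 0 < N.+1%:R^-1 :> R by rewrite invr_gt0.
  have [q [u [t [au qp /andP[t0 tth] Bt]]]] := bad _ (Num.max N%:R r) N0.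
  move: Bt; rewrite gt_max => /andP[Nt rt].
  have acx := (flow_solution f_fc q au.1 t0).1.
  have tt : 0 <= t <= t by rewrite t0 lexx.
  have qr : `|flow q u 0| < r.
    rewrite (flow0 f_fc _ au.1) -(subrK p q) (le_lt_trans (ler_normD _ _))//.
    rewrite (lt_le_trans _ rp)// addrC ltrD2l (le_lt_trans qp)//.
    by rewrite (@le_lt_trans _ _ 1) ?ltr1n// invf_le1 ?ler1n.
  have [s [s0 st sr sw]] := first_hit (abs_continuous_norm acx) tt qr (ltW rt).
  by exists (t, s, u, q); split => //; rewrite ltW.
have [a acr] := choice cross.
pose c N := (flow (a N).2 (a N).1.2 (a N).1.1.2, (a N).1.1.2).
have Kc N : ([set x : 'rV[R]_n | `|x| <= r] `*` `[0, th + 1]%classic) (c N).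
  have := acr N; rewrite /c; case: (a N) => [[[t s] u] q] /= [_ _ /andP[s0 st] tth [_ sr _]].
  rewrite sr lexx in_itv/= s0/= (le_trans st)// (le_trans tth)// lerD2l invf_le1// ler1n//.
have [[p' s'] [/= p'r s'th] cl] := compact_seq_cluster
  (compact_setX (@compact_norm_le R n r) (@segment_compact R 0 (th + 1))) Kc.
have close (e : R) (N : nat) : 0 < e -> exists2 i, (N <= i)%N &
    `|p' - (c i).1| < e /\ `|s' - (c i).2| < e.
  move=> e0; apply: (cl [set y | `|p' - y.1| < e /\ `|s' - y.2| < e]).
  exists ([set x | `|p' - x| < e], [set x | `|s' - x| < e]); last by move=> x.
  split; first exact: (near_dist (p' : 'rV[R]_n) e0).
  exact: (near_dist (s' : R) e0).
exists p', (th - s'); split.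
- move=> e B' e0.
  pose N := maxn (Num.truncn (2 / e)).+1 (Num.truncn B').+1.
  have [|i Ni [ci1 ci2]] := close (e / 2) N; first by rewrite divr_gt0.
  have iB : B' < i%:R.
    rewrite (lt_le_trans (truncnS_gt _))// ler_nat (leq_trans _ Ni)// leq_maxr//.
  have ie : i.+1%:R^-1 <= e / 2.
    rewrite -[leRHS]invrK lef_pV2 ?posrE ?invr_gt0 ?divr_gt0// invf_div.
    rewrite (le_trans (ltW (truncnS_gt _)))// ler_nat (leq_trans _ (leqW Ni))// leq_maxl//.
  have := acr i; move: ci1 ci2; rewrite /c; case: (a i) => [[[t s] u] q] /=.
  move=> ci1 ci2 [au _ /andP[s0 st] tth [Nt sr sw]].
  have {}tth : t <= th + e / 2 by rewrite (le_trans tth)// lerD2l.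
  exists (flow q u s), (fun t => u (t + s)), (t - s); split.
  + exact: admissible_shift.
  + by rewrite distrC; lra.
  + rewrite subr_ge0 st/=; move: ci2; rewrite ltr_distlC => /andP[h1 h2]; lra.
  + by rewrite -(flow_shift f_lip f_fc _ au.1)// ?subr_ge0// subrK (lt_trans iB).
- have : r <= `|p'|.
    apply/ler_addgt0Pr => e e0; have [i _ [+ _]] := close e 0%N e0.
    have := acr i; rewrite /c; case: (a i) => [[[t s] u] q] /= [_ _ _ _ [_ <- _]] h.
    by rewrite -(subrK p' (flow q u s)) addrC (le_trans (ler_normD _ _))// lerD2l distrC ltW.
  by apply: le_trans; rewrite le_max lexx.
- move=> e e0.
  have th10 : 0 <= th + 1 by rewrite addr_ge0.
  have rM0 : 0 <= Num.max r M by rewrite le_max r0.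
  have e20 : 0 < e / 2 by rewrite divr_gt0.
  have [d d0 od] := flow_open_unif f_lip f_fc rM0 th10 e20.
  pose N := (Num.truncn (2 / e)).+1.
  have [|i Ni [ci1 ci2]] := close (Num.min e d) N; first by rewrite lt_min e0.
  have ie : i.+1%:R^-1 <= e / 2.
    rewrite -[leRHS]invrK lef_pV2 ?posrE ?invr_gt0 ?divr_gt0// invf_div.
    rewrite (le_trans (ltW (truncnS_gt _)))// ler_nat (leq_trans _ (leqW Ni))//.
  have := acr i; have [] := Kc i; move: ci1 ci2; rewrite /c; case: (a i) => [[[t s] u] q] /=.
  rewrite !lt_min in_itv/= => /andP[_ p'd] /andP[s'e _] _ sth.
  move=> [au qp /andP[s0 st] tth [_ sr sw]].
  have {}tth : t <= th + e / 2 by rewrite (le_trans tth)// lerD2l.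
  have {}qp : `|q - p| <= e / 2 := le_trans qp ie.
  have [||q' q'q q'p] := od q u s au.1 sth _ _ p' (ltW p'd).
  + by move=> w /sw ws; rewrite le_max ws.
  + by move=> w /andP[w0 _]; rewrite le_max au.2 ?orbT.
  exists q', u, s; split=> //.
  + rewrite -(subrKA q) (le_trans (ler_normD _ _))//; lra.
  + by move: s'e; rewrite ltr_distlC => /andP[h1 h2]; lra.
Qed.

(** After [st_k] steps of the construction, the control [st_u], used until
    time [st_s], steers the initial state [st_x] to [st_p], from where
    trajectories blow up within time [st_th]. The initial states within [st_r]
    of [st_x] are those among which the construction continues. *)
Record stage := Stage { st_k : nat; st_u : R -> 'rV[R]_m; st_s : R;
  st_x : 'rV[R]_n; st_r : R; st_p : 'rV[R]_n; st_th : R }.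

(** The slack in time spent at successive steps is summed geometrically, so
    that all times stay below [A + 1]. *)
Definition stage_ok (A : R) (a : stage) :=
  [/\ admissible (st_u a), 0 <= st_s a, 0 < st_r a & blows_up (st_p a) (st_th a)] /\
  [/\ flow (st_x a) (st_u a) (st_s a) = st_p a,
      forall y, `|y - st_x a| <= st_r a -> `|flow y (st_u a) (st_s a) - st_p a| <= 1,
      st_s a + st_th a <= A + 1 - 2^-1 ^+ st_k a &
      (st_k a)%:R <= `|st_p a| ].

Definition stage_next (a b : stage) := [/\ st_k b = (st_k a).+1, st_s a <= st_s b,
  forall t, t < st_s a -> st_u b t = st_u a t &
  forall y, `|y - st_x b| <= st_r b -> `|y - st_x a| <= st_r a].

(** The step from [st_p] starts at a state [q] near it; by openness of the
    flow, [q] is itself reached from an initial state near [st_x], and the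
    new input is appended to the control. *)
Lemma stage_step (A : R) a : stage_ok A a -> exists2 b, stage_ok A b & stage_next a b.
Proof.
case: a => k u S x r p th [/= [au S0 r0 bad] [xp xr budget kp]].
have [p' [th' [bad' kp' reach]]] := blows_up_step (k.+1%:R) bad.
have r20 : 0 < r / 2 by rewrite divr_gt0.
have [d d0 od] := flow_open f_lip f_fc x au.1 S0 r20.
have e0 : 0 < Num.min d (2^-1 ^+ k.+1) by rewrite lt_min d0 exprn_gt0 ?invr_gt0.
have [q [v [s [av qp s0 sth qvp']]]] := reach _ e0.
have [|x' x'x x'q] := od q.
  by rewrite xp (le_trans qp)// ge_min lexx.
pose w := input_concat u S v.
have aw : admissible w by exact: admissible_concat.
have sS0 : 0 <= s + S by rewrite addr_ge0.
have x'w : flow x' w (s + S) = p'.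
  by rewrite /w flow_concat ?au.1 ?av.1 ?x'q//; [exact: au.1|exact: av.1].
have [d' d'0 cd'] := flow_continuous f_lip f_fc x' aw.1 sS0 ltr01.
exists (Stage k.+1 w (s + S) x' (Num.min d' (r / 2)) p' th'); split => /=.
- by split=> //; rewrite lt_min d'0.
- split=> // [y yx'|].
    by rewrite -x'w; apply: cd'; rewrite (le_trans yx')// ge_min lexx.
  have : s <= th - th' + 2^-1 ^+ k.+1.
    by rewrite (le_trans sth)// lerD2l ge_min lexx orbT.
  have : 2^-1 ^+ k = 2 * 2^-1 ^+ k.+1 :> R by rewrite exprS mulrA mulfV// mul1r.
  by lra.
- by [].
- by rewrite lerDr.
- by move=> t tS; rewrite /w /input_concat tS.
- move=> y yx'; rewrite -(subrKA x') (le_trans (ler_normD _ _))//.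
  have : `|y - x'| <= r / 2 by rewrite (le_trans yx')// ge_min lexx orbT.
  by lra.
Qed.

(** The nested balls have a common point [x] and the controls glue into one
    input on the half-line. The trajectory that they define has norm at least
    [k - 1] at the time of stage [k], whereas forward completeness makes it
    bounded up to time [A + 1]. *)
Lemma stages_absurd (A : R) (a : nat -> stage) : (forall i, stage_ok A (a i)) ->
  (forall i, stage_next (a i) (a i.+1)) -> st_k (a 0%N) = 0%N -> False.
Proof.
move=> ok next k0.
have kE i : st_k (a i) = i.
  by elim: i => [//|i IH]; have [-> _ _ _] := next i; rewrite IH.
have Smono i j : (i <= j)%N -> st_s (a i) <= st_s (a j).
  elim: j => [|j IH]; first by rewrite leqn0 => /eqP ->.
  rewrite leq_eqVlt => /orP[/eqP -> //|ij].
  by have [_ + _ _] := next j; apply: le_trans; exact: IH.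
have uE i j t : (i <= j)%N -> t < st_s (a i) -> st_u (a j) t = st_u (a i) t.
  move=> + ti; elim: j => [|j IH]; first by rewrite leqn0 => /eqP ->.
  rewrite leq_eqVlt => /orP[/eqP -> //|ij].
  have [_ _ ujE _] := next j; rewrite ujE ?IH//.
  by rewrite (lt_le_trans ti)// Smono.
have uE' i j t : t < st_s (a i) -> t < st_s (a j) -> st_u (a i) t = st_u (a j) t.
  move=> ti tj; have [ij|ji] := leqP i j; first by rewrite (uE i j).
  by rewrite (uE j i)// ltnW.
have xr i j : (i <= j)%N -> `|st_x (a j) - st_x (a i)| <= st_r (a i).
  move=> ij; have : forall y, `|y - st_x (a j)| <= st_r (a j) ->
      `|y - st_x (a i)| <= st_r (a i).
    elim: j ij => [|j IH]; first by rewrite leqn0 => /eqP ->.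
    rewrite leq_eqVlt => /orP[/eqP -> //|ij] y yj.
    by apply: IH => //; have [_ _ _] := next j; apply.
  by apply; rewrite subrr normr0; have [[_ _ /ltW]] := ok j.
have SA i : st_s (a i) <= A + 1.
  have [[_ _ _ bad] [_ _ budget _]] := ok i.
  have := blows_up_ge0 bad; have : 0 <= 2^-1 ^+ st_k (a i) :> R.
    by rewrite exprn_ge0 ?invr_ge0.
  by lra.
pose K := [set y : 'rV[R]_n | `|y| <= `|st_x (a 0%N)| + st_r (a 0%N)].
have Kx i : K (st_x (a i)).
  rewrite /K/= -(subrK (st_x (a 0%N)) (st_x (a i))) addrC.
  by rewrite (le_trans (ler_normD _ _))// lerD2l xr.
have [x _ clx] := compact_seq_cluster (@compact_norm_le R n _) Kx.
have xin i : `|x - st_x (a i)| <= st_r (a i).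
  apply/ler_addgt0Pr => e e0; have [j ij /= xj] := clx _ i (near_dist x e0).
  by rewrite -(subrKA (st_x (a j))) addrC (le_trans (ler_normD _ _))// lerD ?xr// ltW.
pose u t := if pselect (exists i, t < st_s (a i)) is left H
            then st_u (a (projT1 (cid H))) t else 0.
have uaE i t : t < st_s (a i) -> u t = st_u (a i) t.
  rewrite /u; case: pselect => [H ti|nH ti]; last by case: nH; exists i.
  by apply: uE' => //; case: (cid H).
have iu : input u.
  pose E : set R := [set st_s (a i) | i in setT].
  have supE : has_sup E.
    split; first by exists (st_s (a 0%N)), 0%N.
    by exists (A + 1) => _ [i _ <-]; exact: SA.
  have ltsup t : t < sup E -> exists i, t < st_s (a i).
    move=> tE; have [|_ [i _ <-] ti] := sup_adherent (eps := sup E - t) _ supE.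
      by rewrite subr_gt0.
    by exists i; rewrite subKr in ti.
  split.
    pose D i : interval R := if i is i'.+1 then `[0, st_s (a i')[ else `[sup E, +oo[.
    have supE0 : 0 <= sup E.
      have [[_ S0 _ _] _] := ok 0%N; apply: le_trans S0 _.
      by apply: (ub_le_sup supE.2); exists 0%N.
    have -> : `[0, +oo[%classic = \bigcup_i [set` D i].
      apply/seteqP; split=> t /=; rewrite in_itv/= andbT.
        move=> t0; have [tE|Et] := ltP t (sup E).
          by have [i ti] := ltsup t tE; exists i.+1 => //=; rewrite in_itv/= t0.
        by exists 0%N => //=; rewrite in_itv/= Et.
      move=> [[|i] _ /=]; rewrite in_itv/= ?andbT; first exact: le_trans.
      by case/andP.
    apply: measurable_on_bigcup => -[|i] /=.
      apply: (eq_measurable_on _ (measurable_on_const (0 : 'rV[R]_m))) => t /=.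
      rewrite in_itv/= andbT /u => Et; case: pselect => // -[i ti].
      have : st_s (a i) <= sup E by apply: (ub_le_sup supE.2); exists i.
      by rewrite leNgt (le_lt_trans Et ti).
    have [[[[mu _] _] _ _ _] _] := ok i.
    apply: eq_measurable_on (measurable_on_sub _ mu).
      by move=> t /=; rewrite in_itv/= => /andP[_ ti]; rewrite (uaE i).
    by move=> t /=; rewrite !in_itv/= => /andP[->].
  move=> b; exists M => t /andP[t0 _]; rewrite /u; case: pselect => [H|_]; last by rewrite normr0.
  by case: (cid H) => i /= ti; have [[[_ ->]]] := ok i.
have A10 : 0 <= A + 1 by have [[_ S0 _ _] _] := ok 0%N; exact: le_trans (SA 0%N).
have [B [_ xB _]] := flow_bounded f_fc x iu A10.
pose N := (Num.truncn (B + 1)).+1.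
have [[[iuN _] S0 _ _] [_ near _ kp]] := ok N.
have := xB (st_s (a N)); rewrite S0 SA => /(_ isT).
rewrite (flow_causal f_lip f_fc x iu iuN (b := st_s (a N))); last 2 first.
- by move=> t /andP[_ tS]; rewrite (uaE N).
- by rewrite S0 lexx.
move=> xNB; have := near x (xin N).
have : B + 1 < `|st_p (a N)|.
  by rewrite (lt_le_trans _ kp)// kE truncnS_gt.
have := lerB_dist (st_p (a N)) (flow x (st_u (a N)) (st_s (a N))).
by rewrite [in X in _ -> _ -> X]distrC; lra.
Qed.

Lemma no_blow_up p (A : R) : ~ blows_up p A.
Proof.
move=> bad.
have u0 : admissible (fun=> 0 : 'rV[R]_m).
  split; last by move=> t _; rewrite normr0.
  by split; [exact: measurable_on_const|move=> b; exists M => t _; rewrite normr0].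
pose a0 := Stage 0%N (fun=> 0 : 'rV[R]_m) 0 p 1 p A.
have ok0 : stage_ok A a0.
  split; first by split => //=; rewrite ltr01.
  split=> /= [|y yp||]; rewrite ?(flow0 f_fc)//; try exact: u0.1.
  by rewrite expr0; lra.
pose T := {a | stage_ok A a}.
have [|a [a0E nexta]] := @dependent_choice T
    (fun a b => stage_next (sval a) (sval b)) _ (exist _ a0 ok0).
  by move=> [a oka]; apply/cid; have [b okb ab] := stage_step oka; exists (exist _ b okb).
apply: (@stages_absurd A (fun i => sval (a i))) => // [i|]; first by case: (a i).
by rewrite a0E.
Qed.

(** By compactness of the set of initial states, trajectories of unbounded size
    would make some initial state blow up. *)
Theorem bounded_reachability (A : R) : 0 <= A -> exists B : R, forall p u t,
  admissible u -> `|p| <= M -> 0 <= t <= A -> `|flow p u t| <= B.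
Proof.
move=> A0; apply: contrapT => unb.
have seq (N : nat) : exists a : 'rV[R]_n * (R -> 'rV[R]_m) * R, let: (p, u, t) := a in
    [/\ admissible u, `|p| <= M, 0 <= t <= A & N%:R < `|flow p u t| ].
  apply: contrapT => nN; apply: unb; exists N%:R => p u t au pM tA.
  by rewrite leNgt; apply/negP => Nt; apply: nN; exists (p, u, t).
have [a aP] := choice seq.
have Ka N : [set y : 'rV[R]_n | `|y| <= M] (a N).1.1.
  by have := aP N; case: (a N) => [[p u] t] [].
have [p _ clp] := compact_seq_cluster (@compact_norm_le R n M) Ka.
apply: (@no_blow_up p A) => e B e0.
have [i Ni] := clp _ (Num.truncn B).+1 (near_dist p e0).
have := aP i; case: (a i) => [[q u] t] /= [au qM /andP[t0 tA] it] pq.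
exists q, u, t; split=> //.
- by rewrite distrC ltW.
- by rewrite t0 (le_trans tA)// lerDl ltW.
- by rewrite (lt_trans (truncnS_gt _))// (le_lt_trans _ it)// ler_nat.
Qed.

End BoundedReachability.

(** * Comparison functions *)

Section ComparisonFunctions.
Variable R : realType.
Implicit Types a b : R -> R.

(** A class-K function extended to a continuous function on the whole line;
    closure properties are then free of domain conditions. *)
Definition extK a := [/\ continuous a, a 0 = 0 &
  forall s s' : R, 0 <= s -> s < s' -> a s < a s'].

Lemma extK_class_K a : extK a -> class_K a.
Proof. by move=> [ca a0 am]; split=> //; exact: continuous_subspaceT. Qed.

Lemma extK_le a (s s' : R) : extK a -> 0 <= s -> s <= s' -> a s <= a s'.
Proof.
move=> [_ _ am] s0; rewrite le_eqVlt => /orP[/eqP -> //|ss'].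
by rewrite ltW// am.
Qed.

Lemma extK_ge0 a (s : R) : extK a -> 0 <= s -> 0 <= a s.
Proof. by move=> aK s0; have [_ <- _] := aK; exact: extK_le. Qed.

Lemma extK_id : extK (@id R).
Proof. by split=> // x; exact: cvg_id. Qed.

Lemma extK_comp a b : extK a -> extK b -> extK (fun s => a (b s)).
Proof.
move=> aK bK; have [ca a0 am] := aK; have [cb b0 bm] := bK; split.
- by move=> x; apply: (@continuous_comp _ _ _ b a); [exact: cb|exact: ca].
- by rewrite b0.
- by move=> s s' s0 ss'; apply: am; [exact: extK_ge0|exact: bm].
Qed.

Lemma extKD a b : extK a -> extK b -> extK (fun s => a s + b s).
Proof.
move=> [ca a0 am] [cb b0 bm]; split.
- by move=> x; apply: cvgD; [exact: ca|exact: cb].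
- by rewrite a0 b0 addr0.
- by move=> s s' s0 ss'; rewrite ltrD ?am ?bm.
Qed.

Lemma extKZ (c : R) a : 0 < c -> extK a -> extK (fun s => c * a s).
Proof.
move=> c0 [ca a0 am]; split.
- by move=> x; apply: cvgM; [exact: cvg_cst|exact: ca].
- by rewrite a0 mulr0.
- by move=> s s' s0 ss'; rewrite ltr_pM2l// am.
Qed.

Lemma continuous_pos_part : continuous (fun s : R => Num.max s 0).
Proof.
move=> x; apply: (@continuous_max _ _ id (cst 0)); [exact: cvg_id|exact: cvg_cst].
Qed.

Lemma within_continuous_retract (X Y Z : topologicalType) (D : set Y)
    (g : Y -> Z) (h : X -> Y) : {within D, continuous g} -> continuous h ->
  (forall x, D (h x)) -> continuous (fun x => g (h x)).
Proof.
move=> /subspace_continuousP cg ch Dh x A gA.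
have H : nbhs x (fun y => D (h y) -> A (g (h y))) := ch x _ (cg (h x) (Dh x) A gA).
have : nbhs x (fun y => A (g (h y))) by apply: filterS H => y; exact.
by [].
Qed.

Lemma class_K_extK a : class_K a -> extK (fun s => a (Num.max s 0)).
Proof.
move=> [ca a0 am]; split.
- apply: (within_continuous_retract (h := fun s : R => Num.max s 0) ca continuous_pos_part) => x.
  by rewrite /= in_itv/= andbT le_max lexx orbT.
- by rewrite maxxx.
- move=> s s' s0 ss'; have s'0 := le_lt_trans s0 ss'.
  by rewrite (max_idPl s0) (max_idPl (ltW s'0)) am.
Qed.

(** A cut-off in [s] that is [0] up to [z / 2], [1] from [z] on, and Lipschitz
    with constant [2 / z]. *)
Definition clamp (z s : R) : R := Num.min 1 (Num.max 0 (2 * s / z - 1)).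

Lemma clamp_lip (z s s' D : R) : 2 * `|s - s'| / z <= D -> 0 < z ->
  clamp z s' <= clamp z s + D.
Proof.
move=> h z0; have h' := h; rewrite /clamp.
have {h} : 2 * s' / z - 1 <= 2 * s / z - 1 + D.
  have : 2 * s' / z - 2 * s / z <= D.
    apply: le_trans h; rewrite -mulrBl ler_pM2r ?invr_gt0// -mulrBr ler_pM2l//.
    by rewrite distrC ler_norm.
  by lra.
have : 0 <= D by apply: le_trans h'; rewrite divr_ge0 ?mulr_ge0// ltW.
by rewrite /Num.min /Num.max; do ?case: ifP; lra.
Qed.

Lemma clamp_ge0 (z s : R) : 0 <= clamp z s.
Proof. by rewrite /clamp le_min ler01 le_max lexx. Qed.

Lemma clamp_le1 (z s : R) : clamp z s <= 1.
Proof. by rewrite /clamp ge_min lexx. Qed.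

Lemma clamp1 (z s : R) : 0 < z -> z <= s -> clamp z s = 1.
Proof.
move=> z0 zs; apply/eqP; rewrite eq_le clamp_le1/= /clamp le_min lexx le_max.
apply/orP; right; have : 1 <= s / z by rewrite ler_pdivlMr// mul1r.
by rewrite -mulrA; lra.
Qed.

Lemma clamp0 (z s : R) : 0 < z -> 2 * s <= z -> clamp z s = 0.
Proof.
move=> z0 zs; apply/eqP; rewrite eq_le clamp_ge0 andbT /clamp ge_min ge_max lexx/=.
by rewrite subr_le0 ler_pdivrMr// mul1r zs orbT.
Qed.

Lemma clamp_mono (z s s' : R) : 0 < z -> s <= s' -> clamp z s <= clamp z s'.
Proof.
move=> z0 ss'; rewrite /clamp.
have : 2 * s / z - 1 <= 2 * s' / z - 1 by rewrite lerB// ler_pM2r ?invr_gt0// ler_pM2l.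
by rewrite /Num.min /Num.max; do ?case: ifP; lra.
Qed.

(** The majorant is the supremum of all values [v], each weighted by the
    cut-off [clamp z] at the scale [z] where it occurs, plus the identity. At
    [s], only values of scale at most [2 * s] count, which bounds the supremum
    and makes it small with [s]; near [s > 0], the weights that vary have scale
    at least [s / 2] and share a Lipschitz constant, which makes it
    continuous. *)
Lemma class_K_majorant (P : R -> R -> Prop) :
  (forall s, exists B, forall s' v, 0 <= s' <= s -> P s' v -> v <= B) ->
  (forall e : R, 0 < e -> exists2 d : R, 0 < d &
     forall s v, 0 <= s <= d -> P s v -> v <= e) ->
  exists2 c, extK c & forall s v, 0 <= s -> P s v -> v <= c s.
Proof.
move=> Pb P0.
pose E s := [set w | w = 0 \/ exists z v, [/\ 0 < z, 0 <= v, P z v & w = v * clamp z s]].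
have E0 s : E s 0 by left.
have Eub s : exists2 B : R, 0 <= B & forall z v, 0 < z -> z <= s -> P z v -> v <= B.
  have [B PB] := Pb s; exists (Num.max B 0); first by rewrite le_max lexx orbT.
  by move=> z v z0 zs Pzv; rewrite le_max (PB z)// (ltW z0).
have supE s : has_sup (E s).
  split; first by exists 0.
  have [B B0 EB] := Eub (2 * s); exists B => _ [->//|[z [v [z0 v0 Pzv ->]]]].
  have [zs|sz] := leP z (2 * s).
    by rewrite (le_trans _ (EB z v z0 zs Pzv))// ler_piMr// clamp_le1.
  by rewrite clamp0 ?mulr0// ltW.
pose c0 s := sup (E s).
have c0_ge w s : E s w -> w <= c0 s by exact: (ub_le_sup (supE s).2).
have c0_le s B : 0 <= B -> (forall z v, 0 < z -> 0 <= v -> P z v -> v * clamp z s <= B) ->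
    c0 s <= B.
  move=> B0 EB; apply: ge_sup; first by exists 0.
  by move=> _ [->//|[z [v [z0 v0 Pzv ->]]]]; exact: EB.
have c0_ge0 s : 0 <= c0 s by exact: c0_ge.
have c0_small e : 0 < e -> exists2 d, 0 < d & forall s, s < d -> c0 s <= e.
  move=> e0; have [d d0 Pd] := P0 e e0; exists (d / 2); first by rewrite divr_gt0.
  move=> s sd; apply: c0_le => [|z v z0 v0 Pzv]; first exact: ltW.
  have [zs|sz] := leP z (2 * s).
    rewrite (@le_trans _ _ v)// ?ler_piMr ?clamp_le1//.
    by apply: (Pd z) => //; rewrite (ltW z0)/=; lra.
  by rewrite clamp0 ?mulr0// ltW.
have c0_mono s s' : s <= s' -> c0 s <= c0 s'.
  move=> ss'; apply: c0_le => // z v z0 v0 Pzv.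
  apply: (@le_trans _ _ (v * clamp z s')); first by rewrite ler_wpM2l// clamp_mono.
  by apply: c0_ge; right; exists z, v.
have c0_cont : continuous c0.
  move=> s0; apply/cvgrPdist_lt => e e0; have [s00|s00] := leP s0 0.
    have e20 : 0 < e / 2 by rewrite divr_gt0.
    have [d d0 cd] := c0_small _ e20.
    have c00 : c0 s0 = 0.
      apply/eqP; rewrite eq_le c0_ge0 andbT; apply: c0_le => // z v z0 v0 Pzv.
      by rewrite clamp0 ?mulr0//; lra.
    near=> s; rewrite c00 sub0r normrN ger0_norm ?c0_ge0//.
    rewrite (@le_lt_trans _ _ (e / 2))//; last by lra.
    by apply: cd; near: s; apply: lt_nbhsl; lra.
  have [B B0 EB] := Eub (4 * s0).
  have lip s s' : s0 / 2 <= s -> s' <= 2 * s0 ->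
      c0 s' <= c0 s + B * (4 * `|s - s'| / s0).
    move=> hs hs'; have D0 : 0 <= 4 * `|s - s'| / s0 by rewrite divr_ge0 ?mulr_ge0// ltW.
    have rhs0 : 0 <= c0 s + B * (4 * `|s - s'| / s0).
      by apply: addr_ge0 => //; exact: mulr_ge0.
    apply: c0_le => // z v z0 v0 Pzv.
    have [zs0|s0z] := leP z (s0 / 2).
      apply: (@le_trans _ _ (v * clamp z s)).
        by rewrite (clamp1 z0 (le_trans zs0 hs)) mulr1 ler_piMr// clamp_le1.
      have vc : v * clamp z s <= c0 s by apply: c0_ge; right; exists z, v.
      by rewrite (le_trans vc)// lerDl mulr_ge0.
    have [sz|zs] := leP (4 * s0) z.
      by rewrite clamp0 ?mulr0//; lra.
    have vB : v <= B by apply: (EB z) => //; exact: ltW.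
    have lipz : clamp z s' <= clamp z s + 4 * `|s - s'| / s0.
      apply: clamp_lip => //.
      have -> : 4 * `|s - s'| / s0 = 2 * `|s - s'| / (s0 / 2) by field; rewrite gt_eqF.
      by rewrite ler_wpM2l ?mulr_ge0// lef_pV2 ?posrE ?divr_gt0// ltW.
    apply: le_trans (ler_wpM2l v0 lipz) _; rewrite mulrDr lerD//.
      by apply: c0_ge; right; exists z, v.
    by rewrite ler_wpM2r.
  have K0 : 0 < B * 4 / s0 + 1 by rewrite ltr_wpDl// divr_ge0 ?mulr_ge0// ltW.
  near=> s.
  have s0s : `|s0 - s| < Num.min (s0 / 2) (e / (B * 4 / s0 + 1)).
    by near: s; apply: (near_dist (s0 : R)); rewrite lt_min !divr_gt0.
  move: s0s; rewrite lt_min => /andP[h1 h2].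
  have /andP[h3 h4] : s0 - s0 / 2 < s < s0 + s0 / 2 by rewrite -ltr_distlC.
  have : B * (4 * `|s0 - s| / s0) < e.
    apply: (@le_lt_trans _ _ ((B * 4 / s0 + 1) * `|s0 - s|)); last by rewrite mulrC -ltr_pdivlMr.
    have -> : B * (4 * `|s0 - s| / s0) = B * 4 / s0 * `|s0 - s| by field; rewrite gt_eqF.
    by rewrite mulrDl mul1r lerDl.
  have l1 : c0 s0 <= c0 s + B * (4 * `|s0 - s| / s0).
    by rewrite distrC; apply: lip; lra.
  have l2 : c0 s <= c0 s0 + B * (4 * `|s0 - s| / s0) by apply: lip; lra.
  by rewrite ltr_norml; lra.
exists (fun s => c0 s + s).
  split.
  - by move=> x; apply: cvgD; [exact: c0_cont|exact: cvg_id].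
  - rewrite addr0; apply/eqP; rewrite eq_le c0_ge0 andbT.
    apply: c0_le => // z v z0 v0 Pzv.
    have -> : clamp z 0 = 0 by apply: clamp0 => //; rewrite mulr0 ltW.
    by rewrite mulr0.
  - by move=> s s' s0 ss'; rewrite ler_ltD// c0_mono// ltW.
move=> s v; rewrite le_eqVlt => /orP[/eqP <- P0v|s0 Psv].
  rewrite addr0 (le_trans _ (c0_ge0 _))//; apply/ler_addgt0Pr => e e0; rewrite add0r.
  by have [d d0 Pd] := P0 e e0; apply: (Pd 0) => //; rewrite lexx ltW.
have [v0|v0] := leP 0 v; last by rewrite (le_trans (ltW v0))// addr_ge0// ltW.
rewrite ler_wpDr ?(ltW s0)//; apply: c0_ge; right; exists s, v; split=> //.
by rewrite clamp1// mulr1.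
Unshelve. all: by end_near.
Qed.

End ComparisonFunctions.

(** * Class-K bounds on the flow *)

Section ReachabilityBounds.
Variables (R : realType) (n m : nat).
Variable f : 'rV[R]_n -> 'rV[R]_m -> 'rV[R]_n.
Hypothesis f_lip : locally_lipschitz f.
Hypothesis f_fc : forward_complete f.
Implicit Types (p q : 'rV[R]_n) (u v w : R -> 'rV[R]_m).
Notation flow := (flow f).

Lemma input_const (c : 'rV[R]_m) : input (fun=> c).
Proof. by split; [exact: measurable_on_const|move=> b; exists `|c|]. Qed.

Lemma input_local w :
  (forall b : R, exists2 v, input v & forall t, 0 <= t < b -> w t = v t) -> input w.
Proof.
move=> loc; split.
  have -> : `[0, +oo[%classic = \bigcup_i `[0, i%:R[%classic :> set R.
    apply/seteqP; split=> t /=; rewrite in_itv/= ?andbT.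
      move=> t0; exists (Num.truncn t).+1 => //=.
      by rewrite in_itv/= t0 truncnS_gt.
    by move=> [i _]; rewrite /= in_itv/= => /andP[].
  apply: measurable_on_bigcup => i; have [v [mv _] vw] := loc i%:R.
  apply: eq_measurable_on (measurable_on_sub _ mv).
    by move=> t /=; rewrite in_itv/= => /vw.
  by move=> t /=; rewrite !in_itv/= => /andP[->].
move=> b; have [v [_ bv] vw] := loc (b + 1); have [M vM] := bv b.
by exists M => t /andP[t0 tb]; rewrite vw ?vM ?t0//=; lra.
Qed.

Lemma eq_input u v : (forall t, 0 <= t -> u t = v t) -> input u -> input v.
Proof. by move=> uv iu; apply: input_local => b; exists u => // t /andP[t0 _]; rewrite uv. Qed.

Lemma input_window v (c : R) : measurable_on `[0, c[ v ->
  (exists M : R, forall t, 0 <= t < c -> `|v t| <= M) ->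
  input (fun t => if t < c then v t else 0).
Proof.
move=> mv [M vM]; have [c0|c0] := ltP c 0.
  apply: eq_input (input_const 0) => t t0.
  by rewrite ltNge (le_trans (ltW c0) t0).
split.
  have -> : `[0, +oo[%classic = `[0, c[%classic `|` `[c, +oo[%classic :> set R.
    by rewrite -itv_bndbnd_setU.
  apply: measurable_on_cup.
    by apply: eq_measurable_on mv => t /=; rewrite in_itv/= => /andP[_ ->].
  apply: (eq_measurable_on _ (measurable_on_const (0 : 'rV[R]_m))) => t /=.
  by rewrite in_itv/= andbT ltNge => ->.
move=> b; exists (Num.max M 0) => t /andP[t0 _]; case: ltP => tc.
  by rewrite le_max vM ?t0.
by rewrite normr0 le_max lexx orbT.
Qed.

(** Since the origin is an equilibrium, [`|f x u|] is at most [L] times the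
    larger of [`|x|] and [`|u|] in the unit box: the Gronwall estimate applies
    with [rho = 1] and [c] the bound on the input. *)
Lemma flow_small (f00 : f 0 0 = 0) (A : R) : 0 <= A ->
  forall e : R, 0 < e -> exists2 d : R, 0 < d & forall p u t, input u ->
    `|p| <= d -> (forall s, 0 <= s -> `|u s| <= d) -> 0 <= t <= A ->
    `|flow p u t| <= e.
Proof.
move=> A0 e e0; have [L L0 lipL] := lipschitz_box f_lip 1.
have [C C1 gC] := @gronwall R n L A (ltW L0) A0.
have C0 : 0 < C := lt_le_trans ltr01 C1.
pose d := Num.min 1 (Num.min e 2^-1 / (2 * C)).
have m0 : 0 < Num.min e 2^-1 by rewrite lt_min e0/= invr_gt0.
have d0 : 0 < d by rewrite lt_min ltr01 divr_gt0// mulr_gt0.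
have d1 : d <= 1 by rewrite ge_min lexx.
have Cd : C * (d + d) <= Num.min e 2^-1.
  have : d <= Num.min e 2^-1 / (2 * C) by rewrite ge_min lexx orbT.
  by rewrite ler_pdivlMr ?mulr_gt0// => h; lra.
have Cde : C * (d + d) <= e by rewrite (le_trans Cd)// ge_min lexx.
have Cd1 : C * (d + d) < 1.
  by rewrite (le_lt_trans Cd)// gt_min invf_lt1 ?ltr1n ?orbT.
exists d => // p u t iu pd ud /andP[t0 tA].
have [acx dx] := flow_solution f_fc p iu t0.
have Cp : C * (`|flow p u 0| + d) <= C * (d + d).
  by rewrite ler_wpM2l ?(ltW C0)// flow0// lerD2r.
have tA0 : t - 0 <= A by rewrite subr0.
have tt : 0 <= t <= t by rewrite t0 lexx.
have := gC _ 0 t d 1 t0 tA0 (ltW d0) acx _ (le_lt_trans Cp Cd1) t tt.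
move=> H; have {}H : `|flow p u t| + d <= C * (`|flow p u 0| + d).
  apply: H; apply: aeS dx => s dx st x1; exists (f (flow p u s) (u s)); first exact: dx.
  have us : `|u s| <= d by apply: ud; case/andP: st => /ltW.
  have := lipL (flow p u s) 0 (u s) 0; rewrite f00 !subr0 normr0 normr0.
  move=> /(_ x1 ler01 (le_trans us d1) ler01) /le_trans; apply.
  rewrite ler_wpM2l ?(ltW L0)// ge_max lerDl (ltW d0)/=.
  by rewrite (le_trans us)// lerDr.
by move: H Cp Cde; lra.
Qed.

(** [bounded_reachability] makes the sizes of the states finite, and
    [flow_small] makes them vanish with the data. *)
Lemma flow_extK (f00 : f 0 0 = 0) (A : R) : 0 <= A -> exists2 a : R -> R, extK a &
  forall p u t (s : R), input u -> 0 <= t <= A -> `|p| <= s ->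
    (forall z, 0 <= z < t -> `|u z| <= s) -> `|flow p u t| <= a s.
Proof.
move=> A0; pose P (s w : R) := exists p u t, [/\ input u, `|p| <= s,
  forall z, 0 <= z -> `|u z| <= s, 0 <= t <= A & w = `|flow p u t| ].
have [||a aK Pa] := @class_K_majorant R P.
- move=> s; have s0 : 0 <= Num.max s 0 by rewrite le_max lexx orbT.
  have [B xB] := bounded_reachability f_lip f_fc s0 A0.
  exists B => s' v /andP[s'0 s's] [p [u [t [iu ps us tA ->]]]]; apply: xB => //.
    by split=> // z z0; rewrite (le_trans (us z z0))// le_max s's.
  by rewrite (le_trans ps)// le_max s's.
- move=> e e0; have [d d0 xd] := flow_small f00 A0 e0; exists d => //.
  move=> s v /andP[s0 sd] [p [u [t [iu ps us tA ->]]]]; apply: xd => //.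
    exact: le_trans ps sd.
  by move=> z z0; rewrite (le_trans (us z z0)).
exists a => // p u t s iu tA ps us.
have s0 : 0 <= s by exact: le_trans ps.
have /andP[t0 _] := tA.
apply: Pa => //; exists p, (input_concat u t (fun=> 0)), t; split=> //.
- by apply: input_concat_input => //; exact: input_const.
- move=> z z0; rewrite /input_concat; case: ltP => zt; last by rewrite normr0.
  by apply: us; rewrite z0.
- congr `|_|; apply: (flow_causal f_lip f_fc p (b := t)) => //.
  + by apply: input_concat_input => //; exact: input_const.
  + by move=> z /andP[_ zt]; rewrite /input_concat zt.
  + by rewrite t0 lexx.
Qed.

(** Shifting time by [r] turns the prediction problem into an initial value
    problem at time [0], whose solution is unique. *)
Lemma predictorE (r tau : R) p u : 0 <= r + tau ->
  input (fun t => u (t - r - tau)) ->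
  predictor f r tau p u = flow p (fun t => u (t - r - tau)) (r + tau).
Proof.
move=> rt0 iu; rewrite /predictor; set P := [set y | _].
have Pval y : P y -> y = flow p (fun t => u (t - r - tau)) (r + tau).
  move=> [x [sx xp <-]].
  have rtau : - r <= tau by lra.
  have sx1 := ode_solutionW (v := fun t => u (t - tau)) rtau (fun t tr => tr) sx.
  have := solution_shift (- r) sx1.
  rewrite opprK addNr [tau + r]addrC => sx2.
  have := flow_unique f_lip f_fc iu sx2 (t := r + tau).
  by rewrite rt0 lexx sub0r xp addrAC subrr add0r; apply.
have Px : P (flow p (fun t => u (t - r - tau)) (r + tau)).
  exists (fun t => flow p (fun t => u (t - r - tau)) (t + r)); split.
  - apply: solution_ode; have := solution_shift r (flow_solution f_fc p iu rt0).
    rewrite sub0r addrAC subrr add0r; apply: eq_solution_input => t _.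
    by rewrite addrK.
  - by rewrite addNr flow0.
  - by rewrite addrC.
by apply: Pval; apply: (xgetI 0 Px).
Qed.

End ReachabilityBounds.

(** * The closed loop: existence and uniqueness *)

Section ClosedLoop.
Variables (R : realType) (n m : nat) (T r tau : R).
Variable f : 'rV[R]_n -> 'rV[R]_m -> 'rV[R]_n.
Variable k : 'rV[R]_n -> 'rV[R]_m.
Hypotheses (T_gt0 : 0 < T) (r_ge0 : 0 <= r) (tau_ge0 : 0 <= tau).
Hypothesis rtau_gt0 : 0 < r + tau.
Hypotheses (f_lip : locally_lipschitz f) (f_fc : forward_complete f).
Implicit Types (p q : 'rV[R]_n) (u v w : R -> 'rV[R]_m) (x y : R -> 'rV[R]_n).
Notation flow := (flow f).
Notation closed_loop := (predictor_solution f k T r tau).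

(** A time shift turns the control, with its initial part, into a function on
    the half-line, to which the notion of input applies. *)
Definition delayed u := fun t => u (t - r - tau).

Let rtau_ge0 : 0 <= r + tau := ltW rtau_gt0.

Let iT_ge0 (i : nat) : 0 <= i%:R * T.
Proof. by rewrite mulr_ge0// ltW. Qed.

Let ltS_T (t : R) : t < (Num.truncn (t / T)).+1%:R * T.
Proof. by rewrite -ltr_pdivrMr// truncnS_gt. Qed.

Lemma delayed_input_window u (u0 : R -> 'rV[R]_m) : Linfty_on `[- r - tau, 0[ u0 ->
  (forall t, - r - tau <= t -> t < 0 -> u t = u0 t) ->
  (forall t, 0 <= t -> u t = 0) -> input (delayed u).
Proof.
move=> [mu0 [M u0M]] uu0 uz.
pose v t := u0 (t - (r + tau)).
apply: (eq_input (u := fun t => if t < r + tau then v t else 0)).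
  move=> t t0; rewrite /delayed /v opprD addrA; case: ltP => trt.
    by rewrite uu0//; lra.
  by rewrite uz//; lra.
apply: input_window.
  have := measurable_on_shift (c := - (r + tau)) mu0.
  congr measurable_on; apply/seteqP; split=> t /=; rewrite !in_itv/= => /andP[h1 h2];
    by apply/andP; split; lra.
exists M => t /andP[t0 trt]; rewrite /v (le_trans (norm_le_enorm _))//.
by apply: u0M; rewrite /= in_itv/=; apply/andP; split; lra.
Qed.

(** The control is the initial one followed by one constant per sampling
    period. *)
Lemma closed_loop_input x0 u0 x u : Linfty_on `[- r - tau, 0[ u0 ->
  closed_loop x u -> initial_condition r tau x0 u0 x u -> input (delayed u).
Proof.
move=> u0L [_ ueq] [_ uu0].
have H (i : nat) : exists2 v, input v &
    forall t, 0 <= t < i%:R * T + (r + tau) -> delayed u t = v t.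
  elim: i => [|i [v iv uv]].
    exists (delayed (fun t => if t < 0 then u0 t else 0)).
      apply: (delayed_input_window u0L) => [t _ ->//|t].
      by rewrite leNgt => /negbTE ->.
    move=> t /andP[t0]; rewrite mul0r add0r => trt; rewrite /delayed.
    have -> : t - r - tau < 0 by lra.
    by rewrite uu0// in_itv/=; apply/andP; split; lra.
  exists (input_concat v (i%:R * T + (r + tau)) (fun=> k (predictor f r tau
    (x (i%:R * T - r)) (history (i%:R * T) u)))).
    by apply: input_concat_input => //; [exact: addr_ge0|exact: input_const].
  move=> t /andP[t0 ti]; rewrite /input_concat; case: ltP => tiT; first by rewrite uv ?t0.
  by rewrite /delayed (ueq i)//; lra.
apply: input_local => b; have [v iv uv] := H (Num.truncn (b / T)).+1.
exists v => // t /andP[t0 tb]; apply: uv; rewrite t0/= (lt_trans tb)//.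
by rewrite (lt_le_trans (ltS_T b))// lerDl.
Qed.

Lemma delayed_state_input u : input (delayed u) -> input (fun t => u (t - tau)).
Proof.
move=> /(input_shift r_ge0); apply: eq_input => t _.
by rewrite /delayed addrK.
Qed.

Lemma closed_loop_flow x u : input (delayed u) -> closed_loop x u ->
  forall t, 0 <= t -> x t = flow (x 0) (fun t => u (t - tau)) t.
Proof.
move=> iu [sx _] t t0.
have sub : `[0, t]%classic `<=` `[0, +oo[%classic.
  by move=> s /=; rewrite !in_itv/= => /andP[->].
have st := ode_solutionW (v := fun t => u (t - tau)) t0 sub sx.
apply: (flow_unique f_lip f_fc (delayed_state_input iu) st).
by rewrite t0 lexx.
Qed.

Lemma predictor_history p u (c : R) : 0 <= c -> input (delayed u) ->
  predictor f r tau p (history c u) =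
  flow p (fun t => u (c + (t - r - tau))) (r + tau).
Proof.
move=> c0 iu; rewrite predictorE//.
apply: eq_input (input_shift c0 iu) => t _; rewrite /delayed /history.
by congr u; lra.
Qed.

Lemma history_input u (c : R) : 0 <= c -> input (delayed u) ->
  input (fun t => u (c + (t - r - tau))).
Proof.
move=> c0 iu; apply: eq_input (input_shift c0 iu) => t _; rewrite /delayed.
by congr u; lra.
Qed.

Lemma eq_predictor_history p u v (c : R) : 0 <= c -> input (delayed u) ->
  input (delayed v) -> (forall t, c - r - tau <= t -> t < c -> u t = v t) ->
  predictor f r tau p (history c u) = predictor f r tau p (history c v).
Proof.
move=> c0 iu iv uv; rewrite !predictor_history//.
apply: (flow_causal f_lip f_fc p (b := r + tau)); try exact: history_input.
  by move=> t /andP[t0 trt]; apply: uv; lra.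
by rewrite rtau_ge0 lexx.
Qed.

(** Both parts of the solution are determined one sampling period at a time:
    the control on a period by data prior to it, then the state over the
    period by uniqueness of solutions. *)
Lemma closed_loop_unique x0 u0 x x' u u' : Linfty_on `[- r - tau, 0[ u0 ->
  closed_loop x u -> initial_condition r tau x0 u0 x u ->
  closed_loop x' u' -> initial_condition r tau x0 u0 x' u' ->
  {in `[- r, +oo[, x =1 x'} /\ {in `[- r - tau, +oo[, u =1 u'}.
Proof.
move=> u0L clx ic clx' ic'.
have iu := closed_loop_input u0L clx ic; have iu' := closed_loop_input u0L clx' ic'.
have [xx0 uu0] := ic; have [xx0' uu0'] := ic'.
have H (i : nat) : (forall t, - r - tau <= t -> t < i%:R * T -> u t = u' t) /\
    (forall t, - r <= t -> t <= i%:R * T -> x t = x' t).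
  elim: i => [|i [uu xx]].
    rewrite mul0r; split=> t h1 h2.
      by rewrite uu0 ?uu0'// in_itv/= h1.
    by rewrite xx0 ?xx0'// in_itv/= h1.
  have uuS t : - r - tau <= t -> t < i.+1%:R * T -> u t = u' t.
    move=> h1 h2; have [h3|h3] := ltP t (i%:R * T); first exact: uu.
    rewrite (clx.2 i)// (clx'.2 i)// xx; last 2 first.
    - by have := iT_ge0 i; lra.
    - by rewrite gerBl.
    congr k; apply: eq_predictor_history => // s s1 s2; apply: uu => //.
    by have := iT_ge0 i; lra.
  split=> // t h1 h2; have [t0|t0] := leP t 0.
    by apply: xx => //; apply: le_trans (iT_ge0 i).
  rewrite (closed_loop_flow iu clx (ltW t0)) (closed_loop_flow iu' clx' (ltW t0)).
  have -> : x 0 = x' 0 by apply: xx => //; rewrite oppr_le0.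
  apply: (flow_causal f_lip f_fc _ (b := t)); try exact: delayed_state_input.
    move=> s /andP[s0 st]; apply: uuS; first by have := r_ge0; lra.
    by have := tau_ge0; lra.
  by rewrite (ltW t0) lexx.
split=> t; rewrite in_itv/= andbT => ht.
  by apply: (H (Num.truncn (t / T)).+1).2 => //; exact: ltW.
exact: (H (Num.truncn (t / T)).+1).1.
Qed.

Section Existence.
Variables (x0 : R -> 'rV[R]_n) (u0 : R -> 'rV[R]_m).
Hypothesis u0L : Linfty_on `[- r - tau, 0[ u0.

Definition state_of u := fun t : R =>
  if t < 0 then x0 t else flow (x0 0) (fun s => u (s - tau)) t.

(** The control after [i] sampling steps, extended by its last value. *)
Fixpoint control_step (i : nat) : R -> 'rV[R]_m :=
  if i is j.+1 then
    fun t => if t < j%:R * T then control_step j t else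
      k (predictor f r tau (state_of (control_step j) (j%:R * T - r))
          (history (j%:R * T) (control_step j)))
  else fun t => if t < 0 then u0 t else 0.

Definition control (t : R) := control_step (Num.truncn (t / T)).+1 t.

Lemma control_step_input i : input (delayed (control_step i)).
Proof.
elim: i => [|i IH].
  apply: (delayed_input_window u0L) => /= [t _ ->//|t].
  by rewrite leNgt => /negbTE ->.
have irt : 0 <= i%:R * T + (r + tau) by exact: addr_ge0.
apply: eq_input (input_concat_input irt IH (input_const _)) => t t0.
rewrite /input_concat /delayed /=.
by have -> : (t < i%:R * T + (r + tau)) = (t - r - tau < i%:R * T) by apply/idP/idP; lra.
Qed.

Lemma control_step_agree i j t : (i <= j)%N -> t < i%:R * T ->
  control_step j t = control_step i t.
Proof.
move=> + ti; elim: j => [|j IH]; first by rewrite leqn0 => /eqP ->.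
rewrite leq_eqVlt => /orP[/eqP -> //|ij] /=.
by rewrite (lt_le_trans ti) ?IH// ler_pM2r// ler_nat.
Qed.

Lemma controlE i t : t < i%:R * T -> control t = control_step i t.
Proof.
move=> ti; rewrite /control; have [ij|ji] := leqP i (Num.truncn (t / T)).+1.
  exact: control_step_agree.
by apply/esym/control_step_agree => //; exact: ltnW.
Qed.

Lemma control_input : input (delayed control).
Proof.
apply: input_local => b; exists (delayed (control_step (Num.truncn (b / T)).+1)).
  exact: control_step_input.
move=> t /andP[t0 tb]; apply: controlE; rewrite (le_lt_trans _ (lt_trans tb (ltS_T b)))//.
by have := rtau_ge0; lra.
Qed.

(** The control is built by recursion on sampling periods, each step computing
    the state from the control known so far. Forward completeness then gives
    the state for the resulting control on the whole half-line, and by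
    causality it agrees with the states used in the recursion. *)
Lemma closed_loop_exists : exists x u,
  closed_loop x u /\ initial_condition r tau x0 u0 x u.
Proof.
exists (state_of control), control; split; last first.
  split=> t; rewrite in_itv/= => /andP[h1 h2].
    rewrite /state_of; case: ltP => // t0.
    have -> : t = 0 by lra.
    by rewrite flow0//; exact: delayed_state_input control_input.
  by rewrite (controlE (i := 0)) ?mul0r//= h2.
split.
  have [acx dx] := (flow_ode f_fc (x0 0) (delayed_state_input control_input)).1.
  have xE t : 0 <= t -> flow (x0 0) (fun s => control (s - tau)) t = state_of control t.
    by rewrite /state_of leNgt => /negbTE ->.
  split.
    move=> a b ab sub; apply: eq_abs_continuous (acx a b ab sub) => t tab.
    by apply: xE; have := sub t; rewrite /= !in_itv/= andbT; exact.
  apply: aeS dx => t dxt tI; have := tI; rewrite interior_itv/= in_itv/= andbT => t0.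
  rewrite -xE ?(ltW t0)//; apply: near_eq_is_derive (dxt tI).
  near=> s; apply: xE; apply: ltW; near: s; exact: lt_nbhsr.
move=> i t h1 h2; rewrite (controlE h2)/= ltNge h1/=.
congr k.
have -> : state_of (control_step i) (i%:R * T - r) = state_of control (i%:R * T - r).
  rewrite /state_of; case: ltP => // h3.
  apply: (flow_causal f_lip f_fc _ (b := i%:R * T - r)).
  - exact: delayed_state_input (control_step_input i).
  - exact: delayed_state_input control_input.
  - by move=> s /andP[_ hs]; rewrite (controlE (i := i))//; have := r_ge0; have := tau_ge0; lra.
  - by rewrite h3 lexx.
apply: eq_predictor_history => //; [exact: control_step_input|exact: control_input|].
by move=> s _ si; rewrite (controlE (i := i)).
Unshelve. all: by end_near. Qed.

End Existence.

End ClosedLoop.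

(** * Assembling the KL estimate *)

Section KLAssembly.
Variable R : realType.
Implicit Types (sigma : R -> R -> R) (a g : R -> R).

(** The exponential term dominates the transient up to time [ts]; [b] and
    [g b] bound the state and the control by the decay of the sampled-data
    system afterwards. *)
Definition KL_envelope sigma g rho1 rho2 (ts s t : R) : R :=
  let b := sigma (Num.max (rho1 s) 0) (Num.max (t - ts) 0) in
  rho2 s * expR (ts - t) + (b + g b).

Lemma KL_envelope_KL sigma g rho1 rho2 (ts : R) : class_KL sigma -> extK g ->
  extK rho1 -> extK rho2 -> class_KL (KL_envelope sigma g rho1 rho2 ts).
Proof.
move=> [cs Ks mons lims] gK r1K r2K.
have [cg g0 _] := gK; have [c1 _ _] := r1K; have [c2 _ _] := r2K.
have p0 (t : R) : 0 <= Num.max t 0 by rewrite le_max lexx orbT.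
have bK (t : R) : extK (fun s => sigma (Num.max (rho1 s) 0) (Num.max (t - ts) 0)).
  exact: (extK_comp (class_K_extK (Ks _ (p0 _))) r1K).
split.
- apply: continuous_subspaceT => /= p.
  have cfst (h : R -> R) : continuous h -> continuous (fun q : R * R => h q.1).
    by move=> ch q; apply: (@continuous_comp _ _ _ fst h); [exact: cvg_fst|exact: ch].
  have csnd (h : R -> R) : continuous h -> continuous (fun q : R * R => h q.2).
    by move=> ch q; apply: (@continuous_comp _ _ _ snd h); [exact: cvg_snd|exact: ch].
  have cp1 : continuous (fun q : R * R => Num.max (rho1 q.1) 0).
    apply: (cfst (fun s => Num.max (rho1 s) 0)) => s.
    by apply: (@continuous_comp _ _ _ rho1 (fun s => Num.max s 0));
      [exact: c1|exact: continuous_pos_part].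
  have cp2 : continuous (fun q : R * R => Num.max (q.2 - ts) 0).
    apply: (csnd (fun s => Num.max (s - ts) 0)) => s.
    apply: (@continuous_comp _ _ _ (fun s => s - ts) (fun s => Num.max s 0)).
      by apply: cvgB; [exact: cvg_id|exact: cvg_cst].
    exact: continuous_pos_part.
  have cb : continuous (fun q : R * R =>
      sigma (Num.max (rho1 q.1) 0) (Num.max (q.2 - ts) 0)).
    apply: (within_continuous_retract (h := fun q : R * R =>
      (Num.max (rho1 q.1) 0, Num.max (q.2 - ts) 0)) cs); last first.
      by move=> q; split; rewrite /= in_itv/= andbT p0.
    move=> q A [[U V] [/= qU qV] UVA].
    have n1 : nbhs q [set w | U (Num.max (rho1 w.1) 0)] := cp1 q U qU.
    have n2 : nbhs q [set w | V (Num.max (w.2 - ts) 0)] := cp2 q V qV.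
    have : nbhs q [set w | A (Num.max (rho1 w.1) 0, Num.max (w.2 - ts) 0)].
      by apply: filterS (filterI n1 n2) => w [wU wV]; exact: UVA.
    by [].
  apply: cvgD; first apply: cvgM.
  + exact: cfst.
  + apply: (csnd (fun t => expR (ts - t))) => t.
    apply: (@continuous_comp _ _ _ (fun t => ts - t) expR); last exact: continuous_expR.
    by apply: cvgB; [exact: cvg_cst|exact: cvg_id].
  + apply: cvgD; first exact: cb.
    by apply: (@continuous_comp _ _ _ _ g); [exact: cb|exact: cg].
- move=> t t0; apply: extK_class_K; apply: extKD.
    have := extKZ (expR_gt0 (ts - t)) r2K; congr extK.
    by apply/funext => s; rewrite mulrC.
  by apply: extKD => //; exact: extK_comp.
- move=> s s0 t t' t0 tt'; rewrite /KL_envelope/=.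
  have b0 (z : R) : 0 <= sigma (Num.max (rho1 s) 0) (Num.max (z - ts) 0).
    exact: (extK_ge0 (bK z) s0).
  have bm : sigma (Num.max (rho1 s) 0) (Num.max (t' - ts) 0) <=
      sigma (Num.max (rho1 s) 0) (Num.max (t - ts) 0).
    apply: mons => //; rewrite ge_max !le_max lexx orbT andbT.
    by rewrite lerB.
  apply: lerD; first by rewrite ler_wpM2l ?(extK_ge0 r2K)// ler_expR lerB.
  by apply: lerD => //; exact: extK_le.
- move=> s s0.
  have b_lim : sigma (Num.max (rho1 s) 0) (Num.max (t - ts) 0) @[t --> +oo] --> (0 : R).
    have tl : (fun t => Num.max (t - ts) 0) @ +oo --> +oo.
      apply/cvgryPge => A; near=> t; rewrite le_max lerBrDr.
      by apply/orP; left; near: t; apply: nbhs_pinfty_ge; exact: num_real.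
    exact: (cvg_comp _ (sigma (Num.max (rho1 s) 0)) tl (lims _ (p0 (rho1 s)))).
  rewrite -[X in _ --> X]addr0; apply: cvgD.
    rewrite -[X in _ --> X](mulr0 (rho2 s)); apply: cvgM; first exact: cvg_cst.
    rewrite (_ : (fun t => _) = (fun t => expR ts * expR (- t))); last first.
      by apply/funext => t; rewrite expRD.
    rewrite -[X in _ --> X](mulr0 (expR ts)); apply: cvgM; first exact: cvg_cst.
    exact: cvgr_expR.
  rewrite -[X in _ --> X]addr0; apply: cvgD => //.
  by rewrite -[X in _ --> X]g0; exact: (cvg_comp _ g b_lim (cg 0)).
Unshelve. all: by end_near. Qed.

End KLAssembly.

Section SupNorm.
Variables (R : realType) (n : nat).
Implicit Types (D : set R) (x : R -> 'rV[R]_n).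

Lemma supnorm_le D x (B : R) : D !=set0 -> (forall t, D t -> enorm (x t) <= B) ->
  supnorm D x <= B.
Proof.
move=> [t Dt] xB; apply: ge_sup; first by exists (enorm (x t)), t.
by move=> _ [s Ds <-]; exact: xB.
Qed.

Lemma enorm_le_supnorm D x t : bounded_on D x -> D t -> enorm (x t) <= supnorm D x.
Proof.
move=> [M xM] Dt; apply: ub_le_sup; last by exists t.
by exists M => _ [s Ds <-]; exact: xM.
Qed.

Lemma continuous_bounded_on a b x : {within `[a, b], continuous x} ->
  bounded_on `[a, b] x.
Proof.
move=> cx; have := compact_bounded (continuous_compact cx (@segment_compact R a b)).
move=> [M [_ MB]]; exists (n%:R * (M + 1)) => t tab.
rewrite (le_trans (enorm_le_norm _))// ler_wpM2l//.
by apply: (MB (M + 1)); rewrite ?ltrDl//; exists t.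
Qed.

End SupNorm.

(** * Bounds on the closed loop *)

Section ClosedLoopBounds.
Variables (R : realType) (n m : nat) (T r tau : R).
Variable f : 'rV[R]_n -> 'rV[R]_m -> 'rV[R]_n.
Variable k : 'rV[R]_n -> 'rV[R]_m.
Hypotheses (T_gt0 : 0 < T) (r_ge0 : 0 <= r) (tau_ge0 : 0 <= tau).
Hypothesis rtau_gt0 : 0 < r + tau.
Hypotheses (f_lip : locally_lipschitz f) (f00 : f 0 0 = 0).
Hypothesis f_fc : forward_complete f.
Implicit Types (p q : 'rV[R]_n) (u v w : R -> 'rV[R]_m) (x y : R -> 'rV[R]_n).
Notation flow := (flow f).
Notation closed_loop := (predictor_solution f k T r tau).

Let iT_ge0 (i : nat) : 0 <= i%:R * T.
Proof. by rewrite mulr_ge0// ltW. Qed.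

(** Exact or not, a prediction is the end point of some trajectory over the
    time [r + tau] with past data, so [flow_extK] bounds it; then [g] bounds
    the control that it defines, and [flow_extK] bounds the state over the next
    period. *)
Lemma closed_loop_bound (g : R -> R) (i : nat) : extK g ->
  (forall q, enorm (k q) <= g (enorm q)) -> exists2 b : R -> R, extK b &
  forall x0 u0 x u (s : R), Linfty_on `[- r - tau, 0[ u0 ->
    closed_loop x u -> initial_condition r tau x0 u0 x u ->
    (forall t, - r <= t <= 0 -> `|x0 t| <= s) ->
    (forall t, - r - tau <= t < 0 -> `|u0 t| <= s) ->
    (forall t, - r <= t <= i%:R * T -> `|x t| <= b s) /\
    (forall t, - r - tau <= t < i%:R * T -> `|u t| <= b s).
Proof.
move=> gK kg; elim: i => [|i [b bK IH]].
  exists id; first exact: extK_id.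
  move=> x0 u0 x u s _ _ [xx0 uu0] x0s u0s; rewrite mul0r.
  by split=> t ht; [rewrite xx0 ?in_itv// x0s|rewrite uu0 ?in_itv// u0s].
have [a1 a1K flow1] := flow_extK f_lip f_fc f00 (ltW rtau_gt0).
have [a2 a2K flow2] := flow_extK f_lip f_fc f00 (iT_ge0 i.+1).
pose b1 s := b s + g (n.+1%:R * a1 (b s)).
have b1K : extK b1.
  apply: extKD => //; apply: (extK_comp gK); apply: extKZ; first by rewrite ltr0n.
  exact: extK_comp.
pose b2 s := b1 s + a2 (b1 s).
have b2K : extK b2 by apply: extKD => //; exact: extK_comp.
exists b2 => // x0 u0 x u s u0L cl ic x0s u0s.
have s0 : 0 <= s by rewrite (le_trans _ (x0s 0 _))// oppr_le0 r_ge0 lexx.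
have bs0 := extK_ge0 bK s0; have b1s0 := extK_ge0 b1K s0.
have gs0 : 0 <= g (n.+1%:R * a1 (b s)).
  by rewrite (extK_ge0 gK)// mulr_ge0// (extK_ge0 a1K).
have bb1 : b s <= b1 s by rewrite lerDl.
have b12 : b1 s <= b2 s by rewrite lerDl (extK_ge0 a2K).
have [xb ub] := IH _ _ _ _ _ u0L cl ic x0s u0s.
have iu := closed_loop_input T_gt0 rtau_gt0 u0L cl ic.
have iT0 := iT_ge0 i; have iTr : i%:R * T - r <= i%:R * T by rewrite gerBl.
have ub1 t : - r - tau <= t < i.+1%:R * T -> `|u t| <= b1 s.
  move=> /andP[h1 h2]; have [h3|h3] := ltP t (i%:R * T).
    by rewrite (le_trans _ bb1)// ub// h1.
  rewrite (cl.2 i)// (le_trans (norm_le_enorm _))// (le_trans (kg _))//.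
  rewrite (@le_trans _ _ (g (n.+1%:R * a1 (b s))))//; last by rewrite lerDr.
  apply: (extK_le gK (enorm_ge0 _)); rewrite (le_trans (enorm_le_norm _))//.
  apply: ler_pM => //; first by rewrite ler_nat.
  rewrite predictor_history//.
  apply: flow1.
  - exact: history_input.
  - by rewrite lexx ltW.
  - by apply: xb; rewrite iTr andbT; lra.
  - by move=> z /andP[z0 zr]; apply: ub; apply/andP; split; lra.
split=> t /andP[h1 h2]; last by rewrite (le_trans _ b12)// ub1// h1.
have [t0|t0] := leP t 0.
  by rewrite (le_trans _ b12)// (le_trans _ bb1)// xb// h1 (le_trans t0).
rewrite (closed_loop_flow r_ge0 f_lip f_fc iu cl (ltW t0)).
apply: (@le_trans _ _ (a2 (b1 s))); last by rewrite lerDr.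
apply: flow2.
- exact: (delayed_state_input r_ge0 iu).
- by rewrite (ltW t0).
- by rewrite (le_trans _ bb1)// xb// oppr_le0 r_ge0.
- move=> z /andP[z0 zt]; apply: ub1.
  by have := r_ge0; have := tau_ge0 => h3 h4; apply/andP; split; lra.
Qed.

(** From time [c - r] on, the state obeys the differential equation that the
    predictor solves, and uniqueness makes both agree. *)
Lemma predictor_exact x u (c : R) : input (delayed r tau u) -> closed_loop x u ->
  r <= c -> predictor f r tau (x (c - r)) (history c u) = x (c + tau).
Proof.
move=> iu cl rc; have c0 : 0 <= c := le_trans r_ge0 rc.
have cr0 : 0 <= c - r by rewrite subr_ge0.
have rt0 : 0 <= r + tau by exact: ltW.
have ct0 : 0 <= c + tau by exact: addr_ge0.
rewrite predictor_history//.
rewrite (closed_loop_flow r_ge0 f_lip f_fc iu cl cr0).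
rewrite (closed_loop_flow r_ge0 f_lip f_fc iu cl ct0).
have -> : c + tau = (r + tau) + (c - r) by lra.
rewrite [RHS](flow_shift f_lip f_fc _ (delayed_state_input r_ge0 iu))//.
congr (flow _ _ _); apply/funext => t; congr u; lra.
Qed.

Lemma ode_solution_sub (F : R -> 'rV[R]_n -> 'rV[R]_n) (I J : set R) x :
  I `<=` J -> ode_solution F J x -> ode_solution F I x.
Proof.
move=> IJ [acx dx]; split=> [a b ab abI|].
  by apply: acx => //; exact: subset_trans IJ.
by apply: aeS dx => t dxt It; apply: dxt; exact: interiorS It.
Qed.

(** From time [i0 * T] on, predictions are exact, so the control at a sampling
    instant is [k] evaluated at the state [tau] later, which is when this
    control reaches the plant. As [tau] is a multiple of [T], the delay maps
    sampling periods to sampling periods. *)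
Lemma sampled_tail x u (i0 l : nat) : input (delayed r tau u) -> closed_loop x u ->
  r <= i0%:R * T -> tau = l%:R * T ->
  sampled_solution f k T (fun t => x (t + (i0 + l)%:R * T)) /\
  forall i t, (i0 + i)%:R * T <= t -> t < (i0 + i).+1%:R * T ->
    u t = k (x (i%:R * T + (i0 + l)%:R * T)).
Proof.
move=> iu cl ri0 tauE; pose c := (i0 + l)%:R * T.
have uE i t : (i0 + i)%:R * T <= t -> t < (i0 + i).+1%:R * T ->
    u t = k (x (i%:R * T + c)).
  move=> h1 h2; rewrite (cl.2 _ _ h1 h2) predictor_exact//.
    by congr (k (x _)); rewrite tauE /c !natrD; lra.
  by rewrite (le_trans ri0)// natrD mulrDl lerDl.
have c0 : 0 <= c := iT_ge0 _.
split=> // i; rewrite -/c.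
have a0 : 0 <= i%:R * T + c by exact: addr_ge0.
have ab : i%:R * T + c <= i.+1%:R * T + c.
  by rewrite lerD2r ler_pM2r// ler_nat.
have sub : `[i%:R * T + c, i.+1%:R * T + c]%classic `<=` `[0, +oo[%classic.
  by move=> t /=; rewrite !in_itv/= andbT => /andP[+ _]; exact: le_trans.
have sx := ode_solutionW (v := fun t => u (t - tau)) ab sub cl.1.
have := solution_shift c sx; rewrite !addrK => sy.
split.
  apply: (@ode_solution_sub _ _ `[i%:R * T, i.+1%:R * T]).
    by move=> t /=; rewrite !in_itv/= => /andP[-> /ltW ->].
  apply: (solution_ode (v := fun=> k (x (i%:R * T + c)))).
  apply: eq_solution_input sy => t /andP[h1 h2]; apply: uE.
    by move: h1; rewrite tauE /c !natrD; lra.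
  by move: h2; rewrite tauE /c -!natr1 !natrD; lra.
apply/cvgrPdist_lt => e e0.
have [d d0 yd] := abs_continuous_unif sy.1 e0.
have iT : i%:R * T < i.+1%:R * T by rewrite ltr_pM2r// ltr_nat.
near=> t.
have tb : t < i.+1%:R * T by near: t; exact: nbhs_left_lt.
have ta : i%:R * T < t by near: t; exact: nbhs_left_gt.
have td : i.+1%:R * T - d < t by near: t; apply: nbhs_left_gt; rewrite gtrBl.
apply: yd.
- by rewrite (ltW ta) ltW.
- by rewrite (ltW iT) lexx.
- by rewrite ger0_norm ?subr_ge0 ?(ltW tb)// ltrBlDr -ltrBlDl.
Unshelve. all: by end_near. Qed.

End ClosedLoopBounds.

(** * Stability of the predictor feedback *)

Theorem theorem3p2 (R : realType) (n m : nat) (T r tau : R) (l : nat)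
    (f : 'rV[R]_n -> 'rV[R]_m -> 'rV[R]_n) (k : 'rV[R]_n -> 'rV[R]_m)
    (g : R -> R) (sigma : R -> R -> R)
    (T_gt0 : 0 < T) (r_ge0 : 0 <= r) (tau_ge0 : 0 <= tau)
    (rtau_gt0 : 0 < r + tau) (tauE : tau = l%:R * T)
    (f_lip : locally_lipschitz f) (f00 : f 0 0 = 0)
    (f_fc : forward_complete f)
    (g_Kinf : class_Kinf g) (kg : forall x, enorm (k x) <= g (enorm x))
    (sigma_KL : class_KL sigma)
    (sampled_bound : forall x : R -> 'rV[R]_n, sampled_solution f k T x ->
       forall t : R, 0 <= t -> enorm (x t) <= sigma (enorm (x 0)) t) :
  [/\ forall (x0 : R -> 'rV[R]_n) (u0 : R -> 'rV[R]_m),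
        {within `[- r, 0], continuous x0} -> Linfty_on `[- r - tau, 0[ u0 ->
        (exists (x : R -> 'rV[R]_n) (u : R -> 'rV[R]_m),
           predictor_solution f k T r tau x u /\
           initial_condition r tau x0 u0 x u) /\
        (forall (x x' : R -> 'rV[R]_n) (u u' : R -> 'rV[R]_m),
           predictor_solution f k T r tau x u ->
           initial_condition r tau x0 u0 x u ->
           predictor_solution f k T r tau x' u' ->
           initial_condition r tau x0 u0 x' u' ->
           {in `[- r, +oo[, x =1 x'} /\ {in `[- r - tau, +oo[, u =1 u'}),
      exists2 sigma' : R -> R -> R, class_KL sigma' &
        forall (x0 : R -> 'rV[R]_n) (u0 : R -> 'rV[R]_m),
          {within `[- r, 0], continuous x0} -> Linfty_on `[- r - tau, 0[ u0 ->
          forall (x : R -> 'rV[R]_n) (u : R -> 'rV[R]_m),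
            predictor_solution f k T r tau x u ->
            initial_condition r tau x0 u0 x u ->
            forall t : R, 0 <= t ->
              supnorm `[- r, 0] (history t x) +
              supnorm `[- r - tau, 0[ (history t u)
              <= sigma' (supnorm `[- r, 0] x0 + supnorm `[- r - tau, 0[ u0) t
    & forall j : nat, (0 < j)%N ->
        (forall x : R -> 'rV[R]_n, sampled_solution f k T x ->
           forall t : R, j%:R * T <= t -> x t = 0) ->
        forall (x0 : R -> 'rV[R]_n) (u0 : R -> 'rV[R]_m),
          {within `[- r, 0], continuous x0} -> Linfty_on `[- r - tau, 0[ u0 ->
          forall (x : R -> 'rV[R]_n) (u : R -> 'rV[R]_m),
            predictor_solution f k T r tau x u ->
            initial_condition r tau x0 u0 x u ->
            forall t : R, (j + l + Num.truncn (r / T) + 1)%:R * T <= t -> x t = 0].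
Proof.
(* [g] is constrained on nonnegative reals only *)
pose gE s := g (Num.max s 0).
have gK : extK gE by apply: class_K_extK; case: g_Kinf.
have kgE q : enorm (k q) <= gE (enorm q) by rewrite /gE (max_idPl (enorm_ge0 q)).
pose i0 := (Num.truncn (r / T)).+1.
have ri0 : r <= i0%:R * T by rewrite -ler_pdivrMr// ltW// truncnS_gt.
(* the time from which the state is a sampled-data trajectory *)
pose c := (i0 + l)%:R * T.
have cE : c = i0%:R * T + tau by rewrite /c natrD mulrDl tauE.
have i0T : 0 <= i0%:R * T by rewrite mulr_ge0// ltW.
have c0 : 0 <= c by rewrite cE addr_ge0.
split.
- move=> x0 u0 _ u0L; split.
    exact: (closed_loop_exists k T_gt0 r_ge0 tau_ge0 rtau_gt0 f_lip f_fc x0 u0L).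
  move=> x x' u u' cl ic cl' ic'.
  exact: (closed_loop_unique T_gt0 r_ge0 tau_ge0 rtau_gt0 f_lip f_fc u0L cl ic cl' ic').
(* The control history at time [ts] starts at [i0 * T + T]: a control value
   relates to the sampling instant before it, hence the extra period. *)
- pose ts := r + tau + (i0%:R * T + T).
  pose N := (Num.truncn (ts / T)).+1.
  have tsN : ts <= N%:R * T by rewrite -ler_pdivrMr// ltW// truncnS_gt.
  have ts0 : 0 <= ts by rewrite /ts; lra.
  have cts : c <= ts by rewrite cE /ts; lra.
  have [b bK hb] := closed_loop_bound T_gt0 r_ge0 tau_ge0 rtau_gt0 f_lip f00 f_fc N gK kgE.
  pose rho1 s := n.+1%:R * b s.
  pose rho2 s := (n.+1 + m.+1)%:R * b s.
  have r1K : extK rho1 by apply: extKZ => //; rewrite ltr0n.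
  have r2K : extK rho2 by apply: extKZ => //; rewrite ltr0n.
  exists (KL_envelope sigma gE rho1 rho2 ts); first exact: KL_envelope_KL.
  move=> x0 u0 cx0 u0L x u cl ic t t0.
  have bx0 := continuous_bounded_on cx0; have bu0 := u0L.2.
  have D0 : (`[- r, 0]%classic : set R) 0 by rewrite /= in_itv/= oppr_le0 r_ge0 lexx.
  have Du : (`[- r - tau, 0[%classic : set R) (- r - tau) by rewrite /= in_itv/= lexx/=; lra.
  set s := supnorm _ x0 + supnorm _ u0.
  have sx0 : 0 <= supnorm `[- r, 0] x0.
    exact: le_trans (enorm_ge0 _) (enorm_le_supnorm bx0 D0).
  have su0 : 0 <= supnorm `[- r - tau, 0[ u0.
    exact: le_trans (enorm_ge0 _) (enorm_le_supnorm bu0 Du).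
  have s0 : 0 <= s by exact: addr_ge0.
  have x0s z : - r <= z <= 0 -> `|x0 z| <= s.
    move=> zr; rewrite (le_trans (norm_le_enorm _))// ler_wpDr//.
    by apply: enorm_le_supnorm; rewrite //= in_itv.
  have u0s z : - r - tau <= z < 0 -> `|u0 z| <= s.
    move=> zr; rewrite (le_trans (norm_le_enorm _))// ler_wpDl//.
    by apply: enorm_le_supnorm; rewrite //= in_itv.
  have [hx hu] := hb _ _ _ _ _ u0L cl ic x0s u0s.
  have iu := closed_loop_input T_gt0 rtau_gt0 u0L cl ic.
  have xE z : - r <= z <= N%:R * T -> enorm (x z) <= rho1 s.
    move=> /hx xz; rewrite (le_trans (enorm_le_norm _))// ler_pM// ler_nat//.
  have uE z : - r - tau <= z < N%:R * T -> enorm (u z) <= m.+1%:R * b s.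
    move=> /hu uz; rewrite (le_trans (enorm_le_norm _))// ler_pM// ler_nat//.
  have rho20 : 0 <= rho2 s by exact: (extK_ge0 r2K).
  have r10 : 0 <= rho1 s by exact: (extK_ge0 r1K).
  have [cs sK smono _] := sigma_KL.
  have [tts|tst] := leP t ts.
    have b0 : 0 <= sigma (Num.max (rho1 s) 0) (Num.max (t - ts) 0).
      have z0 (z : R) : 0 <= Num.max z 0 by rewrite le_max lexx orbT.
      exact: (extK_ge0 (class_K_extK (sK _ (z0 (t - ts)))) r10).
    rewrite /KL_envelope/= ler_wpDr ?addr_ge0 ?(extK_ge0 gK)//.
    apply: (@le_trans _ _ (rho2 s)); last first.
      by rewrite ler_peMr// -[leLHS]expR0 ler_expR subr_ge0.
    rewrite /rho2 natrD mulrDl lerD//.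
      apply: supnorm_le => [|th]; first by exists 0.
      rewrite /= in_itv/= /history => /andP[h1 h2]; apply: xE.
      by apply/andP; split; lra.
    apply: supnorm_le => [|th]; first by exists (- r - tau).
    rewrite /= in_itv/= /history => /andP[h1 h2]; apply: uE.
    by apply/andP; split; lra.
  have [sy uy] := sampled_tail T_gt0 r_ge0 tau_ge0 rtau_gt0 f_lip f_fc iu cl ri0 tauE.
  have tail z : t - ts <= z -> enorm (x (z + c)) <= sigma (rho1 s) (t - ts).
    move=> tz; have tts0 : 0 <= t - ts by rewrite subr_ge0 ltW.
    have z0 : 0 <= z := le_trans tts0 tz.
    have := sampled_bound _ sy z z0; rewrite add0r -/c => /le_trans; apply.
    apply: (@le_trans _ _ (sigma (rho1 s) z)).
      have := extK_le (class_K_extK (sK _ z0)) (enorm_ge0 (x c)) (xE c _).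
      rewrite (max_idPl (enorm_ge0 _)) (max_idPl r10); apply.
      by apply/andP; split; lra.
    exact: smono.
  have eb : sigma (Num.max (rho1 s) 0) (Num.max (t - ts) 0) = sigma (rho1 s) (t - ts).
    by rewrite (max_idPl r10) (max_idPl _)// subr_ge0 ltW.
  rewrite /KL_envelope/= eb; apply: ler_wpDl; first by rewrite mulr_ge0 ?expR_ge0.
  apply: lerD.
    apply: supnorm_le => [|th]; first by exists 0.
    rewrite /= in_itv/= /history => /andP[h1 h2].
    rewrite -(subrK c (t + th)); apply: tail.
    by rewrite cE /ts; lra.
  apply: supnorm_le => [|th]; first by exists (- r - tau).
  rewrite /= in_itv/= /history => /andP[h1 h2].
  set z := t + th; pose j := Num.truncn (z / T).
  have zi0 : i0%:R * T + T <= z by rewrite /z; move: tst; rewrite /ts; lra.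
  have z0 : 0 <= z by apply: le_trans zi0; rewrite addr_ge0// ltW.
  have zT0 : 0 <= z / T by rewrite divr_ge0// ltW.
  have /andP[jz zj] := truncn_itv zT0; rewrite -/j in jz zj.
  rewrite ler_pdivlMr// in jz; rewrite ltr_pdivrMr// in zj.
  have i0j : (i0 <= j)%N.
    rewrite -ltnS -(ltr_nat R) -(ltr_pM2r T_gt0) (le_lt_trans _ zj)//.
    by rewrite (le_trans _ zi0)// lerDl ltW.
  have jE : (i0 + (j - i0))%N = j by rewrite subnKC.
  have uz := uy (j - i0)%N z; rewrite jE -/c in uz.
  rewrite uz// (le_trans (kgE _))//.
  apply: (extK_le gK (enorm_ge0 _)); apply: tail.
  rewrite natrB// mulrBl; move: zj; rewrite -natr1 mulrDl mul1r /z /ts; lra.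
- move=> j j0 dead x0 u0 cx0 u0L x u cl ic t ht.
  have iu := closed_loop_input T_gt0 rtau_gt0 u0L cl ic.
  have [sy _] := sampled_tail T_gt0 r_ge0 tau_ge0 rtau_gt0 f_lip f_fc iu cl ri0 tauE.
  have := dead _ sy (t - c); rewrite -/c subrK; apply.
  rewrite lerBrDr (le_trans _ ht)// /c -mulrDl -natrD ler_pM2r// ler_nat.
  by rewrite -!addnA leq_add2l /i0 addnC addn1.
Qed.
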